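(* Let $B\subset W$ be a good lattice. (i) For every $n\in\mathbb{N}$, the group morphism $r_n:Sp(\mathrm{b}_{n+1})\to Sp(\mathrm{b}_n)$ (resp. $r^*_n:Sp(\mathrm{b}^*_{n+1})\to Sp(\mathrm{b}^*_n)$) is surjective. (ii) The map $g\mapsto(\dot g_n)_{n\in\mathbb{N}}$ (resp. $g\mapsto(\dot g^*_n)_{n\in\mathbb{N}}$) induces an isomorphism of topological groups from $K_B$ onto $\varprojlim Sp(\mathrm{b}_n)$ (resp. $\varprojlim Sp(\mathrm{b}^*_n)$).
   Context: $k$ is a non-archimedean local field of characteristic $0$ with ring of integers $\mathcal{O}$, uniformizer $\varpi$, residue field of characteristic $p\neq2$. $\lambda_\psi\in\mathbb Z$ is fixed (the conductor of a fixed non-trivial additive character $\psi$ of $k$). $(W,\beta)$ is a symplectic $k$-space of finite dimension. A lattice is a compact open $\mathcal{O}$-submodule of $W$; $B^*=\{v\in W:\beta(v,b)\in\varpi^{\lambda_\psi}\mathcal{O}\ \forall b\in B\}$; $B$ is good if $\varpi B^*\subset B\subset B^*$. $K_B$ is the stabilizer of $B$ in $Sp(W)$. For $n\in\mathbb{N}$ (including $0$), $O_n=\mathcal{O}/\varpi^{n+1}\mathcal{O}$, $\mathrm{b}_n=B/\varpi^{n+1}B^*$, $\mathrm{b}^*_n=B^*/\varpi^nB$, with the non-degenerate alternating $O_n$-bilinear forms $\beta_{\mathrm{b}_n}(\bar v,\bar w)=\varpi^{-\lambda_\psi}\beta(v,w)\bmod\varpi^{n+1}$ and $\beta_{\mathrm{b}^*_n}(\bar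 v,\bar w)=\varpi^{1-\lambda_\psi}\beta(v,w)\bmod\varpi^{n+1}$. $Sp(\mathrm{b}_n)$, $Sp(\mathrm{b}^*_n)$ are the groups of $O_n$-linear automorphisms preserving these forms. For $g\in K_B$, $\dot g_n\in Sp(\mathrm{b}_n)$ and $\dot g^*_n\in Sp(\mathrm{b}^*_n)$ are the automorphisms induced by $g$ on the quotients. Every $O_{n+1}$-endomorphism of $\mathrm{b}_{n+1}$ (resp. $\mathrm{b}^*_{n+1}$) induces one of its quotient $\mathrm{b}_n$ (resp. $\mathrm{b}^*_n$); this gives morphisms $r_n$ (resp. $r_n^*$) on the symplectic groups, which are the transition maps of the projective systems. The finite groups carry the discrete topology. *)

(* Defs.v *)
From HB Require Import structures.
From mathcomp Require Import all_boot all_order all_algebra.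
From mathcomp Require Import all_classical topology.

Set Implicit Arguments.
Unset Strict Implicit.
Unset Printing Implicit Defensive.
Import Order.TTheory GRing.Theory Num.Theory.
Local Open Scope ring_scope.
Local Open Scope quotient_scope.
Local Open Scope classical_set_scope.

(* val_ge v N is the fractional ideal varpi^N O of a discretely valued field; *)
(* the value v 0 is never used.                                               *)
Definition val_ge (F : fieldType) (v : F -> int) (N : int) : {pred F} :=
  fun x => (x == 0) || (N <= v x).

(* Nonarchimedean local fields: complete for a normalized discrete valuation, *)
(* with finite residue field. The uniformizer is part of the structure.       *)
Record localField := LocalField {
  lf_sort :> fieldType;
  lf_val : lf_sort -> int;
  unif : lf_sort;
  lf_valM : forall x y : lf_sort, x != 0 -> y != 0 ->
    lf_val (x * y) = lf_val x + lf_val y;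
  lf_valD : forall x y : lf_sort, x != 0 -> y != 0 -> x + y != 0 ->
    Num.min (lf_val x) (lf_val y) <= lf_val (x + y);
  unif_neq0 : unif != 0;
  lf_val_unif : lf_val unif = 1;
  lf_complete : forall u : nat -> lf_sort,
    (forall N : int, exists m : nat, forall i j : nat, (m <= i)%N -> (m <= j)%N ->
       u i - u j \in val_ge lf_val N) ->
    exists l : lf_sort, forall N : int, exists m : nat, forall i : nat,
      (m <= i)%N -> u i - l \in val_ge lf_val N;
  lf_residue_finite : exists s : seq lf_sort,
    forall x, x \in val_ge lf_val 0 ->
      exists2 y, y \in s & x - y \in val_ge lf_val 1
}.
Arguments unif {l}.
Arguments unif_neq0 {l}.

Section FractionalIdeals.
Variable k : localField.
Implicit Types (x y : k) (M N : int).

Definition pideal (N : int) : {pred k} := val_ge (@lf_val k) N.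

Lemma pideal0 N : 0 \in pideal N.
Proof. by rewrite unfold_in /val_ge eqxx. Qed.

Lemma lf_val1 : lf_val (1 : k) = 0.
Proof.
have := lf_valM (oner_neq0 k) (oner_neq0 k); rewrite mulr1 => /esym/eqP.
by rewrite -subr_eq0 addrK => /eqP.
Qed.

Lemma lf_valN1 : lf_val (-1 : k) = 0.
Proof.
have n0 : (-1 : k) != 0 by rewrite oppr_eq0 oner_neq0.
have := lf_valM n0 n0; rewrite mulrNN mulr1 lf_val1 => /esym/eqP.
by rewrite -mulr2n mulrn_eq0 /= => /eqP.
Qed.

Lemma pidealM M N x y : x \in pideal M -> y \in pideal N ->
  x * y \in pideal (M + N).
Proof.
rewrite !unfold_in /val_ge mulf_eq0.
have [->//|x0] := eqVneq x 0; have [->//|y0] /= := eqVneq y 0.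
by move=> ? ?; rewrite lf_valM // lerD.
Qed.

Lemma pidealN N x : x \in pideal N -> - x \in pideal N.
Proof.
move=> xN; rewrite -mulN1r -[N]add0r; apply: pidealM => //.
by rewrite unfold_in /val_ge lf_valN1 lexx orbT.
Qed.

Lemma pidealD N x y : x \in pideal N -> y \in pideal N -> x + y \in pideal N.
Proof.
rewrite !unfold_in /val_ge.
have [->|x0] := eqVneq x 0; first by rewrite add0r.
have [->|y0] := eqVneq y 0; first by rewrite addr0 (negPf x0).
have [//|xy0] /= := eqVneq (x + y) 0.
move=> xN yN; apply: le_trans (lf_valD x0 y0 xy0).
by rewrite le_min xN.
Qed.

Lemma pideal_le M N x : M <= N -> x \in pideal N -> x \in pideal M.
Proof.
rewrite !unfold_in /val_ge => MN /orP[->//|Nx].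
by rewrite (le_trans MN) ?orbT.
Qed.

Lemma pideal_1 N : (1 \in pideal N) = (N <= 0).
Proof. by rewrite unfold_in /val_ge oner_eq0 lf_val1. Qed.

Lemma lf_val_unifz N : lf_val (unif ^ N : k) = N.
Proof.
have u0 := @unif_neq0 k.
have Hn (n : nat) : lf_val (unif ^+ n : k) = n%:Z.
  elim: n => [|n IH]; first by rewrite expr0 lf_val1.
  by rewrite exprS lf_valM ?expf_neq0 // IH lf_val_unif -PoszD add1n.
case: N => n; first exact: Hn.
have := @lf_valM k (unif ^+ n.+1) (unif ^- n.+1).
rewrite mulfV ?expf_neq0 // => /(_ isT); rewrite invr_eq0 expf_neq0 //.
move=> /(_ isT); rewrite lf_val1 Hn => /esym/eqP.
by rewrite addrC addr_eq0 => /eqP->; rewrite NegzE.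
Qed.

Lemma pideal_unifz N : (unif ^ N : k) \in pideal N.
Proof. by rewrite unfold_in /val_ge lf_val_unifz lexx orbT. Qed.

Lemma pideal_unifX (n : nat) : (unif ^+ n : k) \in pideal n.
Proof. exact: (pideal_unifz n). Qed.

Lemma pidealZ N x (c : k) : c \in pideal 0 -> x \in pideal N ->
  c * x \in pideal N.
Proof. by move=> c0 xN; rewrite -[N]add0r pidealM. Qed.

Definition intpred : {pred k} := pideal 0.

Lemma intpred_subring : subring_closed intpred.
Proof.
split=> [|x y xO yO|x y xO yO]; first by rewrite pideal_1.
  by rewrite pidealD // pidealN.
exact: pidealZ.
Qed.

End FractionalIdeals.
Arguments pideal : clear implicits.

HB.instance Definition _ (k : localField) :=
  GRing.isSubringClosed.Build k (@intpred k) (@intpred_subring k).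

Record integers (k : localField) :=
  Integers { integers_val :> k; _ : integers_val \in @intpred k }.
HB.instance Definition _ (k : localField) := [isSub for @integers_val k].
HB.instance Definition _ (k : localField) := [Choice of integers k by <:].
HB.instance Definition _ (k : localField) :=
  [SubChoice_isSubComNzRing of integers k by <:].

(* Index shift: mideal n is the ideal varpi^(n+1) O, so that Oquo n is O_n.   *)
Definition mideal (k : localField) (n : nat) : {pred integers k} :=
  fun a => val a \in pideal k n.+1.

Lemma mideal_idealr (k : localField) n : idealr_closed (@mideal k n).
Proof.
split=> [||a u v uI vI]; first exact: pideal0.
  by rewrite unfold_in /mideal /= pideal_1.
by apply: pidealD => //; apply: pidealZ => //; exact: valP a.
Qed.

HB.instance Definition _ (k : localField) n :=
  isIdealr.Build (integers k) (@mideal k n) (@mideal_idealr k n).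

Definition Oquo (k : localField) (n : nat) : comNzRingType :=
  {ideal_quot (@mideal k n)}.

Definition residue_field (k : localField) := Oquo k 0.

Section Lattices.
Variables (k : localField) (W : vectType k).

Record osubmod := OSubmod {
  osm_set :> W -> Prop;
  osm0 : osm_set 0;
  osmD : forall x y, osm_set x -> osm_set y -> osm_set (x + y);
  osmZ : forall a x, a \in pideal k 0 -> osm_set x -> osm_set (a *: x)
}.

Lemma osmN (M : osubmod) x : M x -> M (- x).
Proof.
move=> Mx; rewrite -scaleN1r; apply: osmZ => //.
by apply: pidealN; rewrite pideal_1.
Qed.

Lemma osmB (M : osubmod) x y : M x -> M y -> M (x - y).
Proof. by move=> Mx My; apply: osmD => //; exact: osmN. Qed.

Program Definition osm_scale (c : k) (M : osubmod) : osubmod :=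
  @OSubmod [set c *: x | x in (M : set W)] _ _ _.
Next Obligation. by move=> c M; exists 0; [exact: osm0|rewrite scaler0]. Qed.
Next Obligation.
move=> c M _ _ [x Mx <-] [y My <-].
by exists (x + y); [exact: osmD|rewrite scalerDr].
Qed.
Next Obligation.
move=> c M a _ aO [x Mx <-].
by exists (a *: x); [exact: osmZ|rewrite !scalerA mulrC].
Qed.

End Lattices.

Section OsubType.
Variables (k : localField) (W : vectType k) (M : osubmod W).

Definition osm_pred : {pred W} := fun x => x \in (M : set W).

Lemma osm_predP x : reflect (M x) (x \in osm_pred).
Proof. by apply: (iffP idP) => [/set_mem|/mem_set]. Qed.

Lemma osm_zmod_closed : zmod_closed osm_pred.
Proof.
split=> [|x y /osm_predP Mx /osm_predP My]; apply/osm_predP.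
  exact: osm0.
exact: osmB.
Qed.

HB.instance Definition _ := GRing.isZmodClosed.Build W osm_pred osm_zmod_closed.

Record osub := OSub { osub_val :> W; _ : osub_val \in osm_pred }.
HB.instance Definition _ := [isSub for osub_val].
HB.instance Definition _ := [Choice of osub by <:].
HB.instance Definition _ := [SubChoice_isSubZmodule of osub by <:].

Lemma osubP (x : osub) : M x. Proof. exact/osm_predP/valP. Qed.

Definition mkOsub (x : W) (Mx : M x) : osub := OSub (introT (osm_predP x) Mx).

Definition osub_scale (a : integers k) (x : osub) : osub :=
  mkOsub (osmZ (valP a) (osubP x)).

Fact osub_scaleA a b x : osub_scale a (osub_scale b x) = osub_scale (a * b) x.
Proof. by apply: val_inj; rewrite /= scalerA. Qed.
Fact osub_scale1 : left_id 1 osub_scale.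
Proof. by move=> x; apply: val_inj; rewrite /= scale1r. Qed.
Fact osub_scaleDr : right_distributive osub_scale +%R.
Proof. by move=> a x y; apply: val_inj; rewrite /= scalerDr. Qed.
Fact osub_scaleDl x : {morph osub_scale^~ x : a b / a + b}.
Proof. by move=> a b; apply: val_inj; rewrite /= scalerDl. Qed.

HB.instance Definition _ := GRing.Zmodule_isLmodule.Build (integers k) osub
  osub_scaleA osub_scale1 osub_scaleDr osub_scaleDl.

End OsubType.

Section IsometryGroup.
Variables (R : nzRingType) (V : lmodType R) (b : V -> V -> R).

Definition isometric_aut (f : V -> V) : Prop :=
  [/\ linear f, bijective f & forall x y, b (f x) (f y) = b x y].

Record Sp := MkSp { Sp_fun :> V -> V; _ : `[< isometric_aut Sp_fun >] }.
HB.instance Definition _ := [isSub for Sp_fun].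
HB.instance Definition _ := [Choice of Sp by <:].

Lemma SpP (f : Sp) : isometric_aut f. Proof. exact/asboolP/(valP f). Qed.

Definition toSp f (fP : isometric_aut f) : Sp := MkSp (introT (asboolP _) fP).

Lemma Sp_ext (f g : Sp) : f =1 g -> f = g.
Proof. by move=> fg; apply: val_inj; apply/funext. Qed.

Lemma isometric_aut_id : isometric_aut idfun.
Proof. by split=> //; exists idfun. Qed.

Lemma isometric_aut_comp f g :
  isometric_aut f -> isometric_aut g -> isometric_aut (f \o g).
Proof.
move=> [lf bf pf] [lg bg pg]; split; last by move=> x y; rewrite /= pf pg.
  by move=> a x y; rewrite /= lg lf.
exact: bij_comp.
Qed.

Lemma isometric_aut_inv f g : isometric_aut f -> cancel f g -> cancel g f ->
  isometric_aut g.
Proof.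
move=> [lf bf pf] fg gf; split; last by move=> x y; rewrite -pf !gf.
  by move=> a x y; apply: (can_inj fg); rewrite lf !gf.
by exists f.
Qed.

Lemma Sp_inv_ex (f : Sp) : exists g : Sp, cancel f g /\ cancel g f.
Proof.
have [_ [g fg gf] _] := SpP f.
by exists (toSp (isometric_aut_inv (SpP f) fg gf)).
Qed.

Definition Sp_one : Sp := toSp isometric_aut_id.
Definition Sp_mul (f g : Sp) : Sp := toSp (isometric_aut_comp (SpP f) (SpP g)).
Definition Sp_inv (f : Sp) : Sp := sval (cid (Sp_inv_ex f)).

Lemma Sp_invK (f : Sp) : cancel f (Sp_inv f).
Proof. by rewrite /Sp_inv; case: cid => ? []. Qed.
Lemma Sp_Kinv (f : Sp) : cancel (Sp_inv f) f.
Proof. by rewrite /Sp_inv; case: cid => ? []. Qed.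

Fact Sp_mulA : associative Sp_mul. Proof. by move=> f g h; apply: Sp_ext. Qed.
Fact Sp_mul1 : left_id Sp_one Sp_mul. Proof. by move=> f; apply: Sp_ext. Qed.
Fact Sp_1mul : right_id Sp_one Sp_mul. Proof. by move=> f; apply: Sp_ext. Qed.
Fact Sp_mulV : left_inverse Sp_one Sp_inv Sp_mul.
Proof. by move=> f; apply: Sp_ext => x /=; exact: Sp_invK. Qed.
Fact Sp_Vmul : right_inverse Sp_one Sp_inv Sp_mul.
Proof. by move=> f; apply: Sp_ext => x /=; exact: Sp_Kinv. Qed.

HB.instance Definition _ :=
  isGroup.Build Sp Sp_mulA Sp_mul1 Sp_1mul Sp_mulV Sp_Vmul.

End IsometryGroup.

(* A group with a topology; continuity of the operations is not part of the   *)
(* structure.                                                                 *)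
HB.structure Definition GroupTopological := { G of Group G & Topological G }.

Section ProjectiveLimit.
Variables (G : nat -> groupType).
Variable r : forall n, {multiplicative G n.+1 -> G n}.
Local Open Scope group_scope.

Record projlim := ProjLim {
  pl_val :> forall n, G n;
  _ : `[< forall n, r n (pl_val n.+1) = pl_val n >] }.
HB.instance Definition _ := [isSub for pl_val].
HB.instance Definition _ := [Choice of projlim by <:].

Lemma projlimP (x : projlim) n : r n (x n.+1) = x n.
Proof. by have /asboolP := valP x; apply. Qed.

Definition toProjlim (x : forall n, G n)
  (xP : forall n, r n (x n.+1) = x n) : projlim :=
  ProjLim (introT (asboolP _) xP).

Lemma projlim_ext (x y : projlim) : (forall n, x n = y n) -> x = y.
Proof. by move=> xy; apply: val_inj; apply: functional_extensionality_dep. Qed.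

Fact pl_1 n : r n 1 = 1.
Proof. by apply: (mulgI (r n 1)); rewrite -gmulfM !mulg1. Qed.
Fact pl_mul (x y : projlim) n : r n (x n.+1 * y n.+1) = x n * y n.
Proof. by rewrite gmulfM !projlimP. Qed.
Fact pl_inv (x : projlim) n : r n (x n.+1)^-1 = (x n)^-1.
Proof. by apply: (mulgI (x n)); rewrite -{1}projlimP -gmulfM !mulgV pl_1. Qed.

Definition projlim_one : projlim := toProjlim pl_1.
Definition projlim_mul (x y : projlim) : projlim := toProjlim (pl_mul x y).
Definition projlim_inv (x : projlim) : projlim := toProjlim (pl_inv x).

Fact projlim_mulA : associative projlim_mul.
Proof. by move=> x y z; apply: projlim_ext => n /=; rewrite mulgA. Qed.
Fact projlim_mul1 : left_id projlim_one projlim_mul.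
Proof. by move=> x; apply: projlim_ext => n /=; rewrite mul1g. Qed.
Fact projlim_1mul : right_id projlim_one projlim_mul.
Proof. by move=> x; apply: projlim_ext => n /=; rewrite mulg1. Qed.
Fact projlim_mulV : left_inverse projlim_one projlim_inv projlim_mul.
Proof. by move=> x; apply: projlim_ext => n /=; rewrite mulVg. Qed.
Fact projlim_Vmul : right_inverse projlim_one projlim_inv projlim_mul.
Proof. by move=> x; apply: projlim_ext => n /=; rewrite mulgV. Qed.

HB.instance Definition _ := isGroup.Build projlim
  projlim_mulA projlim_mul1 projlim_1mul projlim_mulV projlim_Vmul.

HB.instance Definition _ := Topological.copy projlim
  (initial_topology
    (pl_val : projlim -> prod_topology (fun n => discrete_topology (G n)))).

End ProjectiveLimit.

Definition topgroup_iso (G H : GroupTopological.type) (f : G -> H) : Prop :=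
  {morph f : x y / (x * y)%g} /\
  exists g : H -> G, [/\ cancel f g, cancel g f, continuous f & continuous g].

Definition lftop (k : localField) : Type := k.

Section FieldTopology.
Variable k : localField.

HB.instance Definition _ := Choice.copy (lftop k) k.

Definition lf_open : set_system (lftop k) :=
  [set U : set (lftop k) | forall x : k, U x ->
    exists N : int, forall y : k, y - x \in pideal k N -> U y].

Fact lf_openT : lf_open setT. Proof. by move=> x _; exists 0. Qed.

Fact lf_openI : setI_closed lf_open.
Proof.
move=> U V oU oV x [/oU[N NU] /oV[N' NV]]; exists (Num.max N N') => y yx.
by split; [apply: NU|apply: NV]; apply: pideal_le yx; rewrite le_max lexx ?orbT.
Qed.

Fact lf_open_bigU (I : Type) (f : I -> set (lftop k)) :
  (forall i, lf_open (f i)) -> lf_open (\bigcup_i f i).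
Proof.
move=> fo x [i _ /fo[N Nf]]; exists N => y /Nf fy.
by exists i.
Qed.

HB.instance Definition _ :=
  isOpenTopological.Build (lftop k) lf_openT lf_openI lf_open_bigU.

End FieldTopology.

(* The canonical topology of a finite-dimensional space: the product topology *)
(* carried over by coordinates.                                               *)
Definition vtop (k : localField) (V : vectType k) : Type := V.

HB.instance Definition _ (k : localField) (V : vectType k) :=
  Topological.copy (vtop V)
    (initial_topology (VectorInternalTheory.v2r : V -> 'rV[lftop k]_(dim V))).

Definition is_lattice (k : localField) (W : vectType k) (B : osubmod W) : Prop :=
  compact (B : set (vtop W)) /\ open (B : set (vtop W)).

Section Stabilizer.
Variables (k : localField) (W : vectType k) (beta : {skew_symmetric W}).

Local Notation SpW := (Sp (beta : W -> W -> k)).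

Variable B : osubmod W.

Definition stab_pred : {pred SpW} :=
  fun g => `[< [set g x | x in (B : set W)] = (B : set W) >].

Lemma stab_predP (g : SpW) :
  reflect ([set g x | x in (B : set W)] = (B : set W)) (g \in stab_pred).
Proof. exact: asboolP. Qed.

Lemma stab_group_closed : group_closed stab_pred.
Proof.
split=> [|g h /stab_predP gB /stab_predP hB]; apply/stab_predP.
  exact: image_id.
have hVB : [set (h^-1%g : SpW) x | x in (B : set W)] = (B : set W).
  rewrite -{1}hB; apply/seteqP; split=> [_ [_ [x Bx <-] <-]|x Bx].
    by rewrite Sp_invK.
  by exists (h x); [exists x|rewrite Sp_invK].
rewrite -[RHS]gB -{2}hVB; apply/seteqP; split=> [_ [x Bx <-]|_ [_ [x Bx <-] <-]].
  by exists ((h^-1)%g x) => //; exists x.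
by exists x.
Qed.

Record stabilizer := Stab { stab_val :> SpW; _ : stab_val \in stab_pred }.
HB.instance Definition _ := [isSub for stab_val].
HB.instance Definition _ := [Choice of stabilizer by <:].
HB.instance Definition _ :=
  SubChoice_isSubGroup.Build SpW stab_pred stabilizer stab_group_closed.

HB.instance Definition _ := Topological.copy stabilizer
  (initial_topology
    ((fun g => linfun (g : W -> W)) : stabilizer -> vtop 'End(W))).

Lemma stabE (g : stabilizer) : [set g x | x in (B : set W)] = (B : set W).
Proof. exact/stab_predP/valP. Qed.

Lemma stab_mem (g : stabilizer) x : B (g x) <-> B x.
Proof.
split=> [|Bx]; last by rewrite -(stabE g); exists x.
rewrite -{1}(stabE g) => -[y By gyx].
by have [_ /bij_inj gI _] := SpP g; rewrite -(gI _ _ gyx).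
Qed.

End Stabilizer.

Section Towers.
Variables (k : localField) (W : vectType k) (beta : {skew_symmetric W}).
Variable B : osubmod W.

(* What b_n = B / varpi^(n+1) B^* and b^*_n = B^* / varpi^n B have in common: *)
(* quotients M / N_n of a fixed O-module M = tw_top by submodules N_n =       *)
(* tw_bot n, with the form varpi^e beta mod varpi^(n+1), e = tw_exp. The      *)
(* Prop fields are what makes the form, the O_n-module structure, the         *)
(* reduction maps and the action of the stabilizer of B well defined.         *)
Record tower := Tower {
  tw_top : osubmod W;
  tw_bot : nat -> osubmod W;
  tw_exp : int;
  tw_sub : forall n x, tw_bot n x -> tw_top x;
  tw_ann : forall n x, tw_top x -> tw_bot n (unif ^+ n.+1 *: x);
  tw_tors : forall n x, tw_top x ->
    (tw_bot n x <-> tw_bot n.+1 (unif *: x));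
  tw_int : forall x y, tw_top x -> tw_top y ->
    unif ^ tw_exp * beta x y \in pideal k 0;
  tw_ker : forall n x y, tw_top x -> tw_bot n y ->
    unif ^ tw_exp * beta x y \in pideal k n.+1;
  tw_stab_top : forall (g : stabilizer beta B) x, tw_top x -> tw_top (g x);
  tw_stab_bot : forall (g : stabilizer beta B) n x,
    tw_bot n x -> tw_bot n (g x)
}.

Section OneLevel.
Variables (T : tower) (n : nat).

Definition tw_pred : {pred osub (tw_top T)} := fun x => val x \in osm_pred (tw_bot T n).

Lemma tw_predP (x : osub (tw_top T)) : reflect (tw_bot T n (val x)) (x \in tw_pred).
Proof. exact: osm_predP. Qed.

Lemma tw_zmod_closed : zmod_closed tw_pred.
Proof.
split=> [|x y /tw_predP Mx /tw_predP My]; apply/tw_predP.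
  exact: osm0.
exact: osmB.
Qed.

HB.instance Definition _ :=
  GRing.isZmodClosed.Build (osub (tw_top T)) tw_pred tw_zmod_closed.

Definition tquot : Type := {ideal_quot tw_pred}.
HB.instance Definition _ := GRing.Zmodule.on tquot.

Definition tpi (x : osub (tw_top T)) : tquot := \pi_{ideal_quot tw_pred} x.
Definition trepr (x : tquot) : osub (tw_top T) := repr (x : {ideal_quot tw_pred}).

Lemma treprK x : tpi (trepr x) = x. Proof. exact: reprK. Qed.

Lemma tpi_eq x y : tpi x = tpi y <-> tw_bot T n (val x - val y).
Proof.
split=> [/eqP|h].
  by rewrite /tpi -Quotient.idealrBE => /tw_predP.
by apply/eqP; rewrite /tpi -Quotient.idealrBE; apply/tw_predP.
Qed.

Lemma tpiD x y : tpi (x + y) = tpi x + tpi y.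
Proof. exact: (raddfD (\pi_{ideal_quot tw_pred})). Qed.

Lemma tpi0 : tpi 0 = 0.
Proof. exact: (raddf0 (\pi_{ideal_quot tw_pred})). Qed.

Lemma trepr_tpi x : tw_bot T n (val (trepr (tpi x)) - val x).
Proof. by apply/tpi_eq; rewrite treprK. Qed.

Definition Opi (a : integers k) : Oquo k n := \pi_{ideal_quot (@mideal k n)} a.
Definition Orepr (a : Oquo k n) : integers k := repr (a : {ideal_quot (@mideal k n)}).

Lemma OreprK a : Opi (Orepr a) = a. Proof. exact: reprK. Qed.

Lemma Opi_eq a b : Opi a = Opi b <-> (val a - val b \in pideal k n.+1).
Proof.
split=> [/eqP|h].
  by rewrite /Opi -Quotient.idealrBE.
by apply/eqP; rewrite /Opi -Quotient.idealrBE.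
Qed.

Lemma OpiD a b : Opi (a + b) = Opi a + Opi b.
Proof. exact: (raddfD (\pi_{ideal_quot (@mideal k n)})). Qed.
Lemma OpiM a b : Opi (a * b) = Opi a * Opi b.
Proof. exact: (rmorphM (\pi_{ideal_quot (@mideal k n)})). Qed.
Lemma Opi1 : Opi 1 = 1.
Proof. exact: (rmorph1 (\pi_{ideal_quot (@mideal k n)})). Qed.

Definition tscale (a : Oquo k n) (x : tquot) : tquot := tpi (Orepr a *: trepr x).

Lemma tscaleE a x : tscale (Opi a) (tpi x) = tpi (a *: x).
Proof.
apply/tpi_eq => /=; set a' := Orepr _; set x' := trepr _.
have -> : (a' : k) *: (x' : W) - (a : k) *: (x : W) =
    (a' : k) *: ((x' : W) - (x : W)) + ((a' : k) - (a : k)) *: (x : W).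
  by rewrite scalerBr scalerBl addrA subrK.
apply: osmD.
  by apply: osmZ; [exact: (valP a')|exact: trepr_tpi].
have /Opi_eq aa' : Opi a' = Opi a by rewrite OreprK.
have u0 : (unif ^+ n.+1 : k) != 0 by rewrite expf_neq0 ?unif_neq0.
rewrite -[_ - _](divfK u0) -scalerA; apply: osmZ; last first.
  by apply: tw_ann; exact: osubP.
rewrite -(subrr (n.+1 : int)); apply: pidealM => //.
by have := pideal_unifz k (- n.+1%:Z); rewrite -exprnN.
Qed.

Fact tscaleA a b x : tscale a (tscale b x) = tscale (a * b) x.
Proof.
by rewrite -[a]OreprK -[b]OreprK -[x]treprK -OpiM !tscaleE scalerA.
Qed.
Fact tscale1 : left_id 1 tscale.
Proof. by move=> x; rewrite -[x]treprK -Opi1 tscaleE scale1r. Qed.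
Fact tscaleDr : right_distributive tscale +%R.
Proof.
move=> a x y; rewrite -[a]OreprK -[x]treprK -[y]treprK.
by rewrite -tpiD !tscaleE scalerDr tpiD.
Qed.
Fact tscaleDl x : {morph tscale^~ x : a b / a + b}.
Proof.
move=> a b /=; rewrite -[a]OreprK -[b]OreprK -[x]treprK.
by rewrite -OpiD !tscaleE scalerDl tpiD.
Qed.

HB.instance Definition _ := GRing.Zmodule_isLmodule.Build (Oquo k n) tquot
  tscaleA tscale1 tscaleDr tscaleDl.

Lemma tpiZ a x : tpi (a *: x) = Opi a *: tpi x.
Proof. by rewrite -tscaleE. Qed.

Definition tint (x y : osub (tw_top T)) : integers k :=
  Integers (tw_int (osubP x) (osubP y)).

Definition tform (x y : tquot) : Oquo k n := Opi (tint (trepr x) (trepr y)).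

Lemma tformE x y : tform (tpi x) (tpi y) = Opi (tint x y).
Proof.
apply/Opi_eq => /=; rewrite -mulrBr; set x' := trepr _; set y' := trepr _.
have -> : beta (val x') (val y') - beta (val x) (val y) =
    beta (val x') (val y' - val y) + beta (val x' - val x) (val y).
  by rewrite linearBr linearBl /= addrA subrK.
rewrite mulrDr; apply: pidealD.
  by apply: tw_ker; [exact: osubP|exact: trepr_tpi].
rewrite hermC /= expr1 mulN1r mulrN; apply: pidealN.
by apply: tw_ker; [exact: osubP|exact: trepr_tpi].
Qed.

End OneLevel.

Local Notation Spt T n := (Sp (@tform T n)).

Section Reduction.
Variables (T : tower) (n : nat).

Definition tproj (x : tquot T n.+1) : tquot T n := tpi n (trepr x).

Lemma tw_bot_decr x : tw_bot T n.+1 x -> tw_bot T n x.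
Proof.
move=> bx; apply/tw_tors; first exact: tw_sub bx.
by apply: osmZ => //; apply: pideal_le (pideal_unifz k 1).
Qed.

Lemma tprojE x : tproj (tpi n.+1 x) = tpi n x.
Proof. by apply/tpi_eq/tw_bot_decr/trepr_tpi. Qed.

Lemma tproj_surj x : tproj (tpi n.+1 (trepr x)) = x.
Proof. by rewrite tprojE treprK. Qed.

Lemma tprojD x y : tproj (x + y) = tproj x + tproj y.
Proof. by rewrite -[x]treprK -[y]treprK -tpiD !tprojE tpiD. Qed.

Lemma tprojZ a x : tproj (Opi n.+1 a *: x) = Opi n a *: tproj x.
Proof. by rewrite -[x]treprK -tpiZ !tprojE tpiZ. Qed.

Definition unifO : integers k :=
  Integers (pideal_le (ler01) (pideal_unifz k 1) : (unif ^ 1 : k) \in @intpred k).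

Lemma tproj_tors x : tproj x = 0 <-> Opi n.+1 unifO *: x = 0.
Proof.
rewrite -[x]treprK tprojE -tpiZ.
rewrite -!tpi0 !tpi_eq /= !subr0 expr1z; apply: tw_tors; exact: osubP.
Qed.

(* Independent of the choice of representatives for linear u: see tindE. *)
Definition tind (u : tquot T n.+1 -> tquot T n.+1) (x : tquot T n) : tquot T n :=
  tproj (u (tpi n.+1 (trepr x))).

Lemma tindE u x : linear u -> tind u (tproj x) = tproj (u x).
Proof.
move=> lu; set y := tpi n.+1 (trepr (tproj x)).
have e : tproj y = tproj x by rewrite /y tproj_surj.
have /tproj_tors xy0 : tproj (x - y) = 0.
  by apply: (addIr (tproj y)); rewrite -tprojD subrK e add0r.
have u0 : u 0 = 0.
  by have := lu (-1) 0 0; rewrite scaler0 addr0 scaleN1r addNr.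
rewrite /tind -/y -[x in RHS](subrK y) -[x - y]scale1r lu scale1r tprojD.
rewrite [X in _ = X + _](_ : _ = 0) ?add0r //.
by apply/tproj_tors; rewrite -[LHS]addr0 -u0 -lu xy0 addr0.
Qed.

Lemma tind_aut (u : Spt T n.+1) : isometric_aut (@tform T n) (tind u).
Proof.
have lin (v : Spt T n.+1) : linear v by case: (SpP v).
have key (v : Spt T n.+1) x : tind v (tproj x) = tproj (v x).
  by apply: tindE; exact: lin.
split.
- move=> a x y; rewrite -[a]OreprK -[x]tproj_surj -[y]tproj_surj.
  by rewrite -tprojZ -tprojD !key lin tprojD tprojZ.
- exists (tind (u^-1)%g) => x; rewrite -[x]tproj_surj !key; congr tproj.
    exact: Sp_invK.
  exact: Sp_Kinv.
- move=> x y; rewrite -[x]tproj_surj -[y]tproj_surj !key.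
  have [_ _ /(_ (tpi n.+1 (trepr x)) (tpi n.+1 (trepr y)))] := SpP u.
  rewrite -[u (tpi _ (trepr x))]treprK -[u (tpi _ (trepr y))]treprK.
  rewrite !tprojE !tformE => /Opi_eq h; apply/Opi_eq.
  by apply: pideal_le h; rewrite lez_nat.
Qed.

Definition red (u : Spt T n.+1) : Spt T n := toSp (tind_aut u).

Lemma redE u x : red u (tproj x) = tproj (u x).
Proof. by apply: tindE; case: (SpP u). Qed.

Lemma red_mul : {morph red : u v / (u * v)%g}.
Proof.
move=> u v; apply: Sp_ext => x; rewrite -[x]tproj_surj redE.
transitivity (red u (red v (tproj (tpi n.+1 (trepr x))))); last by [].
by rewrite !redE.
Qed.

HB.instance Definition _ :=
  isMultiplicative.Build (Spt T n.+1) (Spt T n) red red_mul.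

End Reduction.

Definition tred (T : tower) (n : nat) : {multiplicative Spt T n.+1 -> Spt T n} :=
  @red T n.

Section Dot.
Variables (T : tower).

Definition tact (g : stabilizer beta B) (x : osub (tw_top T)) : osub (tw_top T) :=
  mkOsub (tw_stab_top g (osubP x)).

Definition tdotf n (g : stabilizer beta B) (x : tquot T n) : tquot T n :=
  tpi n (tact g (trepr x)).

Lemma tdotfE n g x : tdotf g (tpi n x) = tpi n (tact g x).
Proof.
apply/tpi_eq => /=; have [lg _ _] := SpP g.
rewrite -(zmod_morphism_linear lg).
by apply: tw_stab_bot; exact: trepr_tpi.
Qed.

Lemma tdot_aut n g : isometric_aut (@tform T n) (tdotf g).
Proof.
split.
- move=> a x y; rewrite -[a]OreprK -[x]treprK -[y]treprK.
  rewrite -tpiZ -tpiD !tdotfE -tpiZ -tpiD; congr tpi; apply: val_inj => /=.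
  by have [lg _ _] := SpP g; rewrite lg.
- exists (tdotf (g^-1)%g) => x; rewrite -[x]treprK !tdotfE; congr tpi;
    apply: val_inj => /=; [exact: Sp_invK|exact: Sp_Kinv].
- move=> x y; rewrite -[x]treprK -[y]treprK !tdotfE !tformE; congr Opi.
  by apply: val_inj => /=; have [_ _ ->] := SpP g.
Qed.

Definition tdot n (g : stabilizer beta B) : Spt T n := toSp (tdot_aut n g).

Lemma tdot_compat g n : red (tdot n.+1 g) = tdot n g.
Proof.
by apply: Sp_ext => x; rewrite -[x]tproj_surj redE /= tdotfE !tprojE tdotfE.
Qed.

Definition tdot_lim (g : stabilizer beta B) :
    @projlim (fun n => Spt T n) (tred T) :=
  @toProjlim (fun n => Spt T n) (tred T) (fun n => tdot n g) (tdot_compat g).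

End Dot.

End Towers.

Notation Spt T n := (Sp (@tform _ _ _ _ T n)).

Section GoodLattices.
Variables (k : localField) (W : vectType k) (beta : {skew_symmetric W}).
Variable lambda : int.

Program Definition dual (B : osubmod W) : osubmod W :=
  @OSubmod k W [set v | forall b, B b -> beta v b \in pideal k lambda] _ _ _.
Next Obligation. by move=> B b Bb; rewrite linear0l pideal0. Qed.
Next Obligation.
by move=> B x y hx hy b Bb; rewrite linearDl pidealD ?hx ?hy.
Qed.
Next Obligation.
by move=> B a x aO hx b Bb; rewrite linearZl_LR; apply: pidealZ => //; exact: hx.
Qed.

Definition good (B : osubmod W) : Prop :=
  (osm_scale unif (dual B) `<=` B) /\ (B `<=` dual B).

Lemma dual_stab (B : osubmod W) (g : stabilizer beta B) x :
  dual B x -> dual B (g x).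
Proof.
move=> dx b; rewrite -{1}(stabE g) => -[c Bc <-].
by have [_ _ ->] := SpP g; exact: dx.
Qed.

Lemma scale_stab (B M : osubmod W) (g : stabilizer beta B) c x :
  (forall y, M y -> M (g y)) -> osm_scale c M x -> osm_scale c M (g x).
Proof.
move=> gM [y My <-]; exists (g y); first exact: gM.
have [lg _ _] := SpP g.
by rewrite (scalable_linear lg).
Qed.

Variable B : osubmod W.
Hypothesis goodB : good B.

Lemma unif_sc (n : nat) (M : osubmod W) x : M x -> M (unif ^+ n *: x).
Proof.
move=> Mx; apply: osmZ => //; apply: pideal_le (pideal_unifX k n) => //.
Qed.

Lemma scale_tors (n : nat) (M : osubmod W) x :
  osm_scale (unif ^+ n) M x <-> osm_scale (unif ^+ n.+1) M (unif *: x).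
Proof.
split=> [[y My <-]|[y My]]; first by exists y; rewrite // scalerA exprS.
by rewrite exprS -scalerA => /(scalerI unif_neq0) <-; exists y.
Qed.

Fact beta_skew x y : beta x y = - beta y x.
Proof. by rewrite hermC /= expr1 mulN1r. Qed.

Fact b_sub n x : osm_scale (unif ^+ n.+1) (dual B) x -> B x.
Proof.
case=> y dy <-; rewrite exprSr -scalerA; apply: unif_sc.
by apply: goodB.1; exists y.
Qed.

Fact b_ann n x : B x -> osm_scale (unif ^+ n.+1) (dual B) (unif ^+ n.+1 *: x).
Proof. by move=> Bx; exists x => //; exact: goodB.2. Qed.

Fact b_int x y : B x -> B y -> unif ^ (- lambda) * beta x y \in pideal k 0.
Proof.
move=> Bx By; rewrite -(addNr lambda).
by apply: pidealM; [exact: pideal_unifz|exact: goodB.2].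
Qed.

Fact b_ker n x y : B x -> osm_scale (unif ^+ n.+1) (dual B) y ->
  unif ^ (- lambda) * beta x y \in pideal k n.+1.
Proof.
move=> Bx [z dz <-]; rewrite linearZr_LR /= mulrCA beta_skew !mulrN.
rewrite -[n.+1 : int]addr0 -(addNr lambda); apply: pidealN.
by do ?apply: pidealM; [exact: pideal_unifX|exact: pideal_unifz|exact: dz].
Qed.

Fact bstar_sub n x : osm_scale (unif ^+ n) B x -> dual B x.
Proof. by case=> y By <-; apply: unif_sc; exact: goodB.2. Qed.

Fact bstar_ann n x : dual B x -> osm_scale (unif ^+ n) B (unif ^+ n.+1 *: x).
Proof.
move=> dx; exists (unif *: x); first by apply: goodB.1; exists x.
by rewrite scalerA exprSr.
Qed.

Fact bstar_int x y : dual B x -> dual B y ->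
  unif ^ (1 - lambda) * beta x y \in pideal k 0.
Proof.
move=> dx dy; rewrite expfzDr ?unif_neq0 // mulrAC -(subrr lambda).
apply: pidealM; last exact: pideal_unifz.
have -> : unif ^ 1 * beta x y = beta x (unif *: y).
  by rewrite linearZr_LR /= expr1z.
by apply: dx; apply: goodB.1; exists y.
Qed.

Fact bstar_ker n x y : dual B x -> osm_scale (unif ^+ n) B y ->
  unif ^ (1 - lambda) * beta x y \in pideal k n.+1.
Proof.
move=> dx [z Bz <-]; rewrite linearZr_LR /= mulrCA.
have -> : (n.+1 : int) = n%:Z + (1 - lambda + lambda) by rewrite subrK intS addrC.
by do ?apply: pidealM; [exact: pideal_unifX|exact: pideal_unifz|exact: dx].
Qed.

Definition tower_b : tower beta B :=
  @Tower k W beta B B (fun n => osm_scale (unif ^+ n.+1) (dual B)) (- lambda)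
    b_sub b_ann (fun n x _ => scale_tors n.+1 (dual B) x) b_int b_ker
    (fun g x => (stab_mem g x).2)
    (fun g n x => @scale_stab B (dual B) g (unif ^+ n.+1) x (@dual_stab B g)).

Definition tower_bstar : tower beta B :=
  @Tower k W beta B (dual B) (fun n => osm_scale (unif ^+ n) B) (1 - lambda)
    bstar_sub bstar_ann (fun n x _ => scale_tors n B x) bstar_int bstar_ker
    (@dual_stab B)
    (fun g n x => @scale_stab B B g (unif ^+ n) x
      (fun y => (stab_mem g y).2)).

End GoodLattices.

(* Main.v *)
Require Import Defs.
From HB Require Import structures.
From mathcomp Require Import all_boot all_order all_algebra.
From mathcomp Require Import all_classical topology.
From mathcomp Require Import zify ring.

(* Both towers are quotients M / N_n of a lattice M by N_n = {w | b(w, M)     *)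
(* lies in varpi^(n+1) O}, where b = varpi^e beta (for b^*_n this uses        *)
(* B^** = B). Splitting off hyperbolic planes on which b has least valuation  *)
(* gives an O-basis e_q of M made of orthogonal hyperbolic pairs whose form   *)
(* values have valuation a_q, and goodness forces a_q to be 0 or 1. Given u   *)
(* in Sp(M / N_n), lifts to M of the images u(e_q) satisfy the relations of   *)
(* the basis up to a small error; a Gram-Schmidt process makes them exact     *)
(* without leaving their classes mod N_n, so e_q |-> z_q defines an element   *)
(* of the stabilizer inducing u. Hence K_B maps onto every Sp(M / N_n), which *)
(* gives (i). Bijectivity in (ii) follows by completeness and because the N_n *)
(* intersect in 0; the topologies agree because the sets                      *)
(* {h | h = g on M / N_n} form a neighbourhood basis of g in K_B.             *)

Set Implicit Arguments.
Unset Strict Implicit.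
Unset Printing Implicit Defensive.
Import Order.TTheory GRing.Theory Num.Theory VectorInternalTheory.
Local Open Scope ring_scope.
Local Open Scope classical_set_scope.

(** Both halves of the theorem are instances of [tower_theorem], for [tower_b] and [tower_bstar]. It
    asks that [N_n] be the annihilator [in_ann] and that an isometry preserving [M] stabilize [B];
    for [B^*] both rest on [dual_dual]. The basis comes from [hyperbolic_basis], and [tdot_surj]
    lifts an isometry of one finite level to the stabilizer. This takes no limit:
    [gram_schmidt_step] repairs one hyperbolic pair by dividing by a form value of valuation [a p],
    but the vectors of that pair have all their products with [M] divisible by [varpi^(a p)], so the
    loss is regained and the change stays in [N_n]. Pairs that are already exact remain exact, hence
    finitely many steps suffice. Completeness enters only in [tdot_lim_surj], where lifts of the
    components of a coherent sequence converge on the basis. The topologies are compared in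
    [nbhs_stabP]. *)

(** * Valuation estimates in fractional ideals *)

Section PidealTheory.
Variable k : localField.
Implicit Types (x y c : k) (N a : int).

Lemma pidealB N x y : x \in pideal k N -> y \in pideal k N ->
  x - y \in pideal k N.
Proof. by move=> xN yN; rewrite pidealD ?pidealN. Qed.

Lemma pideal_sum N (I : finType) (F : I -> k) :
  (forall i, F i \in pideal k N) -> \sum_i F i \in pideal k N.
Proof.
move=> FN; apply: (big_ind (fun x => x \in pideal k N)) => //; first exact: pideal0.
by move=> x y; exact: pidealD.
Qed.

Lemma lf_valV x : x != 0 -> lf_val x^-1 = - lf_val x.
Proof.
move=> x0; have := @lf_valM k x x^-1 x0; rewrite invr_eq0 => /(_ x0).
by rewrite divff // lf_val1 => /esym/eqP; rewrite addrC addr_eq0 => /eqP.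
Qed.

Lemma pidealNE x N : x \notin pideal k N -> x != 0 /\ lf_val x < N.
Proof. by rewrite unfold_in /val_ge negb_or -ltNge => /andP. Qed.

Lemma pidealV c a : c \notin pideal k (a + 1) ->
  c != 0 /\ c^-1 \in pideal k (- a).
Proof.
move=> /pidealNE[c0 va]; split=> //.
rewrite unfold_in /val_ge invr_eq0 (negPf c0) /= lf_valV //; lia.
Qed.

Lemma pideal_div N a x c : c \notin pideal k (a + 1) -> x \in pideal k N ->
  x / c \in pideal k (N - a).
Proof. by move=> /pidealV[_ cV] xN; exact: pidealM. Qed.

Lemma pideal_unifM N (n : nat) x :
  (unif ^+ n * x \in pideal k (n%:Z + N)) = (x \in pideal k N).
Proof.
apply/idP/idP => h; last by apply: pidealM => //; exact: pideal_unifX.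
have u0 : (unif ^+ n : k) != 0 by rewrite expf_neq0 ?unif_neq0.
rewrite -[x](mulKf u0) -[N](addKr n%:Z); apply: pidealM => //.
by have := pideal_unifz k (- n%:Z); rewrite -exprnN.
Qed.

Lemma pideal_cap0 x : (forall n : nat, x \in pideal k n) -> x = 0.
Proof.
move=> xn; apply/eqP/negPn/negP => x0.
have := xn `|lf_val x|.+1; rewrite unfold_in /val_ge (negPf x0) /=; lia.
Qed.

Lemma pideal_ex x : exists n : nat, x \in pideal k (- n%:Z).
Proof.
exists `|lf_val x|%N; rewrite unfold_in /val_ge; apply/orP; right; lia.
Qed.

End PidealTheory.

(** * Hyperbolic bases of a lattice *)

Section HyperbolicSystems.
Variables (k : localField) (W : vectType k) (b : W -> W -> k) (M : osubmod W).
Hypothesis b_lin : forall c x y z, b (c *: x + y) z = c * b x z + b y z.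
Hypothesis b_skew : forall x y, b x y = - b y x.
Hypothesis b_alt : forall x, b x x = 0.
Hypothesis b_int : forall x y, M x -> M y -> b x y \in pideal k 0.
Hypothesis b_nondeg : forall x, (forall y, b x y = 0) -> x = 0.
Hypothesis M_absorb : forall x, exists n, M (unif ^+ n *: x).

Let bDl x y z : b (x + y) z = b x z + b y z.
Proof. by have := b_lin 1 x y z; rewrite scale1r mul1r. Qed.
Let b0l z : b 0 z = 0.
Proof. by apply: (addrI (b 0 z)); rewrite -bDl !addr0. Qed.
Let bZl c x z : b (c *: x) z = c * b x z.
Proof. by have := b_lin c x 0 z; rewrite b0l !addr0. Qed.
Let bNl x z : b (- x) z = - b x z.
Proof. by rewrite -scaleN1r bZl mulN1r. Qed.
Let bDr x y z : b z (x + y) = b z x + b z y.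
Proof. by rewrite ![b z _]b_skew bDl opprD. Qed.
Let bZr c x z : b z (c *: x) = c * b z x.
Proof. by rewrite ![b z _]b_skew bZl mulrN. Qed.
Let bNr x z : b z (- x) = - b z x.
Proof. by rewrite ![b z _]b_skew bNl. Qed.
Let b0r z : b z 0 = 0.
Proof. by rewrite b_skew b0l oppr0. Qed.
Let b_suml (I : finType) (F : I -> W) z : b (\sum_i F i) z = \sum_i b (F i) z.
Proof. exact: (big_morph (b^~ z) (fun x y => bDl x y z) (b0l z)). Qed.
Let b_sumr (I : finType) (F : I -> W) z : b z (\sum_i F i) = \sum_i b z (F i).
Proof. exact: (big_morph (b z) (fun x y => bDr x y z) (b0r z)). Qed.

Lemma osm_sum (I : finType) (F : I -> W) : (forall i, M (F i)) -> M (\sum_i F i).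
Proof.
by move=> MF; apply: (big_ind (M : W -> Prop)) => //; [exact: osm0|exact: osmD].
Qed.

(* The pairs (e q, e (s q)) span mutually orthogonal hyperbolic planes, and   *)
(* a q is the valuation both of b (e q) (e (s q)) and of the ideal b M (e q). *)
Record hyperbolic_system (I : finType) (s : I -> I) (e : I -> W)
    (a : I -> nat) : Prop := HyperbolicSystem {
  hs_invol : involutive s;
  hs_mem : forall q, M (e q);
  hs_orth : forall q r, r != s q -> b (e q) (e r) = 0;
  hs_val : forall q, b (e q) (e (s q)) \notin pideal k ((a q)%:Z + 1);
  hs_sym : forall q, a (s q) = a q;
  hs_ideal : forall q x, M x -> b x (e q) \in pideal k (a q)
}.

(** Among the [e r], only [e q] pairs nontrivially with [e (s q)], so this quotient is the
    coordinate along [e q]. *)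
Definition hcoef (I : finType) (s : I -> I) (e : I -> W) x q :=
  b x (e (s q)) / b (e q) (e (s q)).

Definition hcombine (I : finType) (s : I -> I) (e z : I -> W) x :=
  \sum_q hcoef s e x q *: z q.

Section Projection.
Variables (I : finType) (s : I -> I) (e : I -> W) (a : I -> nat).
Hypothesis hs : hyperbolic_system s e a.

Lemma hs_neq0 q : b (e q) (e (s q)) != 0.
Proof. by have [] := pidealV (hs_val hs q). Qed.

Lemma hs_neq q : s q != q.
Proof. by apply/eqP => sq; have := hs_neq0 q; rewrite sq b_alt eqxx. Qed.

Lemma hcoef_lin c x y q :
  hcoef s e (c *: x + y) q = c * hcoef s e x q + hcoef s e y q.
Proof. by rewrite /hcoef b_lin mulrDl mulrA. Qed.

Lemma hcoef_basis q r : hcoef s e (e q) r = (q == r)%:R.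
Proof.
rewrite /hcoef; have [->|qr] := eqVneq q r; first by rewrite divff ?hs_neq0.
rewrite (hs_orth hs) ?mul0r //.
by apply: contra qr => /eqP/(can_inj (hs_invol hs)) ->.
Qed.

Lemma hcoef_int x q : M x -> hcoef s e x q \in pideal k 0.
Proof.
move=> Mx; rewrite -(subrr (a q)%:Z); apply: pideal_div (hs_val hs q) _.
by rewrite -(hs_sym hs); exact: (hs_ideal hs).
Qed.

Lemma hcombine_mem z x : (forall q, M (z q)) -> M x -> M (hcombine s e z x).
Proof. by move=> Mz Mx; apply: osm_sum => q; apply: osmZ; rewrite ?hcoef_int. Qed.

Lemma hcombine_lin z c x y :
  hcombine s e z (c *: x + y) = c *: hcombine s e z x + hcombine s e z y.
Proof.
rewrite /hcombine scaler_sumr -big_split; apply: eq_bigr => q _ /=.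
by rewrite hcoef_lin scalerDl scalerA.
Qed.

Lemma hcombine_basis z q : hcombine s e z (e q) = z q.
Proof.
rewrite /hcombine (bigD1 q) //= hcoef_basis eqxx scale1r.
rewrite big1 ?addr0 // => r rq.
by rewrite hcoef_basis eq_sym (negPf rq) scale0r.
Qed.

Definition hproj x := x - hcombine s e e x.

Lemma hproj_mem x : M x -> M (hproj x).
Proof. by move=> Mx; apply: osmB => //; apply: hcombine_mem => //; exact: hs_mem hs. Qed.

Lemma hproj_orth x q : b (hproj x) (e q) = 0.
Proof.
rewrite /hproj bDl bNl /hcombine b_suml (bigD1 (s q)) //= big1 => [|r rq].
  rewrite addr0 bZl /hcoef (hs_invol hs) divfK ?subrr //.
  by have := hs_neq0 (s q); rewrite (hs_invol hs).
rewrite bZl (hs_orth hs) ?mulr0 //.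
by apply: contra rq => /eqP ->; rewrite (hs_invol hs).
Qed.

Lemma hproj_form x y : (forall q, b y (e q) = 0) -> b (hproj x) y = b x y.
Proof.
move=> ye; rewrite /hproj bDl bNl /hcombine b_suml big1 ?subr0 // => q _.
by rewrite bZl b_skew ye oppr0 mulr0.
Qed.

(** The functionals [hcoef] are dual to the [e q], so these are linearly independent. The bound
    stops the growth in [hyperbolic_basis]. *)
Lemma hs_card : (#|I| <= \dim {:W})%N.
Proof.
pose X := [tuple e (enum_val i) | i < #|I|].
suff fr : free X by have := dimvS (subvf <<X>>%VS); rewrite (eqP fr) size_tuple.
apply/freeP => c c0 i.
have Xe (j : 'I_#|I|) : X`_j = e (enum_val j) by rewrite -tnth_nth tnth_mktuple.
have := congr1 (fun x => hcoef s e x (enum_val i)) c0.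
rewrite {2}/hcoef b0l mul0r /hcoef b_suml mulr_suml (bigD1 i) // big1 => [|j ji].
  by rewrite Xe bZl -mulrA -/(hcoef s e _ _) hcoef_basis eqxx mulr1 /= addr0.
rewrite Xe bZl -mulrA -/(hcoef s e _ _) hcoef_basis (inj_eq enum_val_inj).
by rewrite (negPf ji) mulr0.
Qed.

End Projection.

(* Splits off a plane spanned by vectors of M, orthogonal to the system, on   *)
(* which the form takes its least valuation.                                  *)
Lemma hs_extend (I : finType) (s : I -> I) (e : I -> W) (a : I -> nat) x0 y0 :
  hyperbolic_system s e a -> M x0 -> M y0 ->
  (forall q, b x0 (e q) = 0) -> (forall q, b y0 (e q) = 0) -> b x0 y0 != 0 ->
  exists (s' : I + bool -> I + bool) e' a', hyperbolic_system s' e' a'.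
Proof.
move=> hs Mx0 My0 x0e y0e xy0.
pose P (n : nat) := `[< exists x y, [/\ M x, M y, forall q, b x (e q) = 0,
  forall q, b y (e q) = 0 & b x y \notin pideal k (n%:Z + 1)] >].
have exP : exists n, P n.
  exists `|lf_val (b x0 y0)|%N; apply/asboolP; exists x0, y0; split=> //.
  rewrite unfold_in /val_ge (negPf xy0) /=; lia.
case: (ex_minnP exP) => n /asboolP[x [y [Mx My xe ye vxy]]] nmin.
(* Projecting [z] off the system keeps its product with [w] and makes the pair a competitor in [P];
   minimality of [n] then bounds the product, or integrality if [n = 0]. *)
have ideal z w : M z -> M w -> (forall q, b w (e q) = 0) -> b z w \in pideal k n.
  move=> Mz Mw we; rewrite -(@hproj_form _ s e z w we).
  case: n nmin {vxy} => [|n] nmin; first by apply: b_int => //; exact: hproj_mem hs _ _.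
  apply/negPn/negP => h; have : P n.
    apply/asboolP; exists (hproj s e z), w; split=> //; first exact: hproj_mem hs _ _.
      exact: (hproj_orth hs).
    by rewrite -PoszD addn1.
  by move=> /nmin; rewrite ltnn.
exists (fun q => match q with inl q => inl (s q) | inr c => inr (~~ c) end).
exists (fun q => match q with inl q => e q | inr c => if c then y else x end).
exists (fun q => match q with inl q => a q | inr c => n end).
split.
- by case=> [q|c]; rewrite ?(hs_invol hs) ?negbK.
- by case=> [q|[]] //; exact: hs_mem hs q.
- case=> [q|c] [r|d]; rewrite ?(inj_eq inl_inj) ?(inj_eq inr_inj) => qr.
  + exact: (hs_orth hs).
  + by rewrite b_skew; case: d {qr}; rewrite ?xe ?ye oppr0.
  + by case: c {qr}; rewrite ?xe ?ye.
  + by case: c d qr => [] [].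
- case=> [q|[]] /=; [exact: hs_val hs q| |exact: vxy].
  by rewrite b_skew; apply: contra vxy => /pidealN; rewrite opprK.
- by case=> [q|c] //; exact: hs_sym hs q.
- case=> [q|[]] z Mz /=; [exact: hs_ideal hs q z Mz| |]; exact: ideal.
Qed.

(** If no system spans, each one can be enlarged by a plane, against the dimension bound. *)
Lemma hyperbolic_basis : exists (I : finType) (s : I -> I) (e : I -> W) a,
  hyperbolic_system s e a /\ forall x, hcombine s e e x = x.
Proof.
apply: contrapT => nex.
have grow m : exists (I : finType) (s : I -> I) (e : I -> W) a,
    hyperbolic_system s e a /\ (m <= #|I|)%N.
  elim: m => [|m [I [s [e [a [hs mI]]]]]].
    exists void, id, (fun=> 0), (fun=> 0%N).
    by split=> //; split; case.
  have [x [y [Mx My xe ye xy]]] : exists x y, [/\ M x, M y,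
      forall q, b x (e q) = 0, forall q, b y (e q) = 0 & b x y != 0].
    apply: contrapT => nxy; apply: nex; exists I, s, e, a; split=> // x.
    (* Some multiple of [x] by a power of the uniformizer lies in [M], and projection is linear. *)
    suff Mgen y : M y -> hproj s e y = 0.
      have [n /Mgen] := M_absorb x; rewrite -[_ *: x]addr0.
      rewrite /hproj hcombine_lin => /eqP; rewrite subr_eq0 => /eqP.
      have -> : hcombine s e e 0 = 0.
        by rewrite /hcombine big1 // => q _; rewrite /hcoef b0l mul0r scale0r.
      by rewrite !addr0 => /(scalerI (expf_neq0 _ unif_neq0)).
    move=> My; apply: b_nondeg => w.
    have [n Mw] := M_absorb w; apply/eqP; apply: contrapT => /negP nz.
    apply: nxy; exists (hproj s e y), (hproj s e (unif ^+ n *: w)).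
    split; [exact: hproj_mem hs _ My|exact: hproj_mem hs _ Mw| | |].
    + exact: (hproj_orth hs).
    + exact: (hproj_orth hs).
    rewrite b_skew hproj_form; last exact: (hproj_orth hs).
    rewrite -b_skew bZr mulf_neq0 // expf_neq0 //; exact: unif_neq0.
  have [s' [e' [a' hs']]] := hs_extend hs Mx My xe ye xy.
  exists (I + bool)%type, s', e', a'; split=> //.
  by rewrite card_sum card_bool; lia.
have [I [s [e [a [hs]]]]] := grow (\dim {:W}).+1.
by rewrite ltnNge (hs_card hs).
Qed.

Definition in_ann n w := forall y, M y -> b w y \in pideal k n.+1.

Lemma in_annD n x y : in_ann n x -> in_ann n y -> in_ann n (x + y).
Proof. by move=> xn yn w Mw; rewrite bDl pidealD ?xn ?yn. Qed.

Lemma in_ann_le m n x : (m <= n)%N -> in_ann n x -> in_ann m x.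
Proof. by move=> mn xn w Mw; apply: pideal_le (xn w Mw). Qed.

Lemma in_ann_cap x : (forall n, in_ann n x) -> x = 0.
Proof.
move=> xn; apply: b_nondeg => y; have [m My] := M_absorb y.
apply: (mulfI (expf_neq0 m (@unif_neq0 k))); rewrite mulr0 -bZr.
apply: pideal_cap0 => n; apply: pideal_le (xn n _ My); lia.
Qed.

Hypothesis ann_sub : forall x, in_ann 0 x -> M x.

(** * Frames and the Gram-Schmidt process *)

Section Frames.
Variables (I : finType) (s : I -> I) (e : I -> W) (a : I -> nat).
Hypothesis hs : hyperbolic_system s e a.
Hypothesis hs_gen : forall x, hcombine s e e x = x.

(** The multiple of [e q] by [varpi^(1 - a q)] has all its products with [M] in [varpi O], so it
    lies in [M] by [ann_sub]; its coordinate along [e q] must then be integral. *)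
Lemma hs_le1 q : (a q <= 1)%N.
Proof.
pose w := unif ^ (1 - (a q)%:Z) *: e q.
have Mw : M w.
  apply: ann_sub => y My; rewrite bZl b_skew mulrN; apply: pidealN.
  by apply: pideal_le (pidealM (pideal_unifz k _) (hs_ideal hs q My)); lia.
have := hcoef_int hs q Mw; rewrite /hcoef bZl mulfK ?(hs_neq0 hs) //.
rewrite unfold_in /val_ge lf_val_unifz expfz_eq0 (negPf unif_neq0) andbF /=.
lia.
Qed.

(** These are the divisibility properties of the [e q], asked of their candidate images; the second
    one pays for the divisions by form values. *)
Definition frame_vec (z : I -> W) := forall q,
  M (z q) /\ forall x, M x -> b x (z q) \in pideal k (a q).

Lemma frame_vec_near n z z' : (forall q, in_ann n (z' q - z q)) ->
  frame_vec z -> frame_vec z'.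
Proof.
move=> zz' fz q; have [Mz za] := fz q; rewrite -[z' q](subrK (z q)); split.
  by apply: osmD => //; apply: ann_sub; apply: in_ann_le (zz' q).
move=> x Mx; rewrite bDr pidealD ?za // b_skew pidealN //.
by apply: pideal_le (zz' q x Mx); have := hs_le1 q; lia.
Qed.

Section GramSchmidt.
Variables (n : nat).

Definition defect z q r := b (z q) (z r) - b (e q) (e r).

(* The second bound makes b (z q) (z (s q)) of valuation exactly a q when     *)
(* a q = 1 and n = 0, where the first one is not enough.                      *)
Definition almost_isometric (z : I -> W) := forall q r,
  defect z q r \in pideal k n.+1 /\
  defect z q r \in pideal k ((a q)%:Z + (a r)%:Z).

Definition exact_at (z : I -> W) q := forall r, defect z q r = 0.

(** The vector [z p] is rescaled to give the pair its prescribed product, and the other vectors are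
    projected off the plane of the pair. The new defects are the old ones corrected by products of
    two defects divided by [c]. *)
Lemma gram_schmidt_step (z : I -> W) p :
  frame_vec z -> almost_isometric z ->
  exists z', [/\ forall q, in_ann n (z' q - z q), almost_isometric z',
    exact_at z' p, exact_at z' (s p) & forall q, exact_at z q -> exact_at z' q].
Proof.
move=> fz az.
set x := z p; set y := z (s p); set c := b x y; set J := b (e p) (e (s p)).
(* For [a p = 0] the second bound follows from the first; for [a p = 1] it is the second bound of
   [almost_isometric], since then [a p + a (s p) = 2]. *)
have Jc : c - J \in pideal k n.+1 /\ c - J \in pideal k ((a p)%:Z + 1).
  have [h1 h2] := az p (s p); split=> //; have := hs_le1 p.
  case ap: (a p) => [|[|m]] // _; first by apply: pideal_le h1; lia.
  by move: h2; rewrite (hs_sym hs) ap.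
have cV : c \notin pideal k ((a p)%:Z + 1).
  apply: contra (hs_val hs p) => cp; rewrite -/J -[J](subKr c).
  by apply: pidealB => //; exact: Jc.2.
have [c0 _] := pidealV cV.
have ann_z N q d : d \in pideal k (N - (a p)%:Z) -> (q == p) || (q == s p) ->
    forall w, M w -> b (d *: z q) w \in pideal k N.
  move=> dN qp w Mw; rewrite bZl b_skew mulrN; apply: pidealN.
  rewrite -[N](subrK (a p)%:Z); apply: pidealM => //.
  have -> : a p = a q by case/orP: qp => /eqP->; rewrite ?(hs_sym hs).
  exact: (fz q).2.
pose z' r := if r == p then (J / c) *: x else if r == s p then y else
  z r - (b (z r) y / c) *: x + (b (z r) x / c) *: y.
have psp : (s p == p) = false by exact/negbTE/(hs_neq hs).
have z'p : z' p = (J / c) *: x by rewrite /z' eqxx.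
have z'sp : z' (s p) = y by rewrite /z' psp eqxx.
have z'r r : r != p -> r != s p ->
    z' r = z r - (b (z r) y / c) *: x + (b (z r) x / c) *: y.
  by rewrite /z' => /negbTE-> /negbTE->.
have defy r : r != p -> b (z r) y = defect z r (s p).
  move=> rp; rewrite /defect (hs_orth hs) ?subr0 //.
  by apply: contra rp => /eqP/(can_inj (hs_invol hs))->.
have defx r : r != s p -> b (z r) x = defect z r p.
  move=> rp; rewrite /defect (hs_orth hs) ?subr0 //.
  by apply: contra rp => /eqP->; rewrite (hs_invol hs).
have orthx r : r != p -> r != s p -> b (z' r) x = 0.
  move=> rp rsp; rewrite z'r // !bDl bNl !bZl b_alt mulr0 subr0.
  by rewrite [b y x]b_skew -/c mulrN divfK // subrr.
have orthy r : r != p -> r != s p -> b (z' r) y = 0.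
  move=> rp rsp; rewrite z'r // !bDl bNl !bZl b_alt mulr0 addr0.
  by rewrite -/c divfK // subrr.
have exp : exact_at z' p.
  move=> r; rewrite /defect z'p bZl.
  have [->|rp] := eqVneq r p; first by rewrite z'p bZr !b_alt !mulr0 subr0.
  have [->|rsp] := eqVneq r (s p); first by rewrite z'sp -/c divfK // subrr.
  by rewrite b_skew orthx // oppr0 mulr0 (hs_orth hs) // subrr.
have exsp : exact_at z' (s p).
  move=> r; rewrite /defect z'sp.
  have [->|rp] := eqVneq r p.
    by rewrite z'p bZr b_skew -/c mulrN divfK // b_skew opprK addNr.
  have [->|rsp] := eqVneq r (s p); first by rewrite z'sp !b_alt subrr.
  rewrite b_skew orthy // oppr0 (hs_orth hs) ?(hs_invol hs) // subrr //.
have exr q r : (r == p) || (r == s p) -> defect z' q r = 0.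
  rewrite /defect [b (z' q) _]b_skew [b (e q) _]b_skew -opprD => /orP[]/eqP->.
    by have := exp q; rewrite /defect => ->; rewrite oppr0.
  by have := exsp q; rewrite /defect => ->; rewrite oppr0.
have form q r : q != p -> q != s p -> r != p -> r != s p ->
    defect z' q r = defect z q r - defect z q (s p) * defect z p r / c
                    + defect z q p * defect z (s p) r / c.
  move=> qp qsp rp rsp; rewrite {1}/defect (z'r r) //.
  rewrite !bDr bNr !bZr orthx // orthy // !mulr0 subr0 addr0.
  rewrite z'r // !bDl bNl !bZl -/x -/y defy // defx //.
  have -> : b x (z r) = defect z p r by rewrite /defect (hs_orth hs) ?subr0.
  have -> : b y (z r) = defect z (s p) r.
    by rewrite /defect (hs_orth hs) ?subr0 // (hs_invol hs).
  rewrite /defect; ring.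
exists z'; split=> //.
- move=> q; have [->|qp] := eqVneq q p.
    rewrite z'p -[X in _ - X]scale1r -scalerBl.
    have -> : J / c - 1 = - (c - J) / c by rewrite mulNr mulrBl divff // opprB.
    apply: (ann_z _ p); rewrite ?eqxx // mulNr; apply: pidealN.
    by apply: pideal_div cV _; exact: Jc.1.
  have [->|qsp] := eqVneq q (s p).
    by rewrite z'sp subrr => w _; rewrite b0l pideal0.
  rewrite z'r // addrAC [z q - _]addrC addrK -scaleNr; apply: in_annD => w Mw.
    apply: (ann_z _ p); rewrite ?eqxx //; apply: pidealN.
    by apply: pideal_div cV _; rewrite defy //; exact: (az q (s p)).1.
  apply: (ann_z _ (s p)); rewrite ?eqxx ?orbT //.
  by apply: pideal_div cV _; rewrite defx //; exact: (az q p).1.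
- move=> q r.
  have [qp|/norP[qp qsp]] := boolP ((q == p) || (q == s p)).
    have -> : defect z' q r = 0 by case/orP: qp => /eqP->.
    by rewrite !pideal0.
  have [rp|/norP[rp rsp]] := boolP ((r == p) || (r == s p)).
    by rewrite exr // !pideal0.
  rewrite form //; have [q1 q2] := az q (s p); have [q3 q4] := az q p.
  have [r1 r2] := az p r; have [r3 r4] := az (s p) r; have [qr1 qr2] := az q r.
  (* The division costs [a p], and the second bound on the other defect returns it. *)
  have big N N' d d' : d \in pideal k N -> d' \in pideal k N' ->
      d * d' / c \in pideal k (N + N' - (a p)%:Z).
    by move=> dN dN'; apply: pideal_div cV _; exact: pidealM.
  rewrite (hs_sym hs) in q2 r4.
  split; (apply: pidealD; first apply: pidealB) => //.
  + by apply: pideal_le (big _ _ _ _ q1 r2); clear; lia.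
  + by apply: pideal_le (big _ _ _ _ q3 r4); clear; lia.
  + by apply: pideal_le (big _ _ _ _ q2 r2); clear; lia.
  + by apply: pideal_le (big _ _ _ _ q4 r4); clear; lia.
(* Each correction term in [form] has a factor [defect z q _], which vanishes. *)
- move=> q exq r.
  have [qp|/norP[qp qsp]] := boolP ((q == p) || (q == s p)).
    by case/orP: qp => /eqP->.
  have [rp|/norP[rp rsp]] := boolP ((r == p) || (r == s p)); first exact: exr.
  by rewrite form // !exq !mul0r subr0 addr0.
Qed.

Lemma gram_schmidt (z : I -> W) : frame_vec z -> almost_isometric z ->
  exists z', (forall q, in_ann n (z' q - z q)) /\ forall q, exact_at z' q.
Proof.
move=> fz az.
suff [z' [zz' _ exz']] : exists z', [/\ forall q, in_ann n (z' q - z q),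
    almost_isometric z' & forall q, q \in enum I -> exact_at z' q].
  by exists z'; split=> // q; apply: exz'; rewrite mem_enum.
elim: (enum I) => [|p l [z1 [zz1 az1 ex1]]].
  exists z; split=> // q.
  by move=> w _; rewrite subrr b0l pideal0.
have [z2 [zz2 az2 exp _ ex2]] := gram_schmidt_step p (frame_vec_near zz1 fz) az1.
exists z2; split=> // q.
  by rewrite -[z2 q](subrK (z1 q)) -addrA; exact: in_annD.
by rewrite inE => /orP[/eqP->//|ql]; apply/ex2/ex1.
Qed.

End GramSchmidt.

(** The map is an isometry because [z] and [e] have the same Gram matrix, and it is bijective by
    nondegeneracy and finite dimension. If [g x] is in [M], the coordinates of [x] are products of
    [g x] with the [z q] over form values, hence integral. *)
Lemma frame_isometry z : frame_vec z -> (forall q, exact_at z q) ->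
  let g := hcombine s e z in
  [/\ linear g, bijective g, forall x y, b (g x) (g y) = b x y &
      forall x, M (g x) <-> M x].
Proof.
move=> fz exz g.
have glin : linear g by move=> c x y; exact: hcombine_lin.
have giso x y : b (g x) (g y) = b x y.
  rewrite -[x in RHS]hs_gen -[y in RHS]hs_gen /g /hcombine !b_suml.
  apply: eq_bigr => q _; rewrite !bZl !b_sumr; congr (_ * _).
  by apply: eq_bigr => r _; rewrite !bZr; have /eqP := exz q r; rewrite subr_eq0 => /eqP->.
have ginj : injective g.
  move=> x y gxy; apply/eqP; rewrite -subr_eq0; apply/eqP/b_nondeg => w.
  by rewrite bDl bNl -(giso x) -(giso y) gxy subrr.
split=> //.
  pose gl : {linear W -> W} := HB.pack g (GRing.isLinear.Build _ _ _ _ g glin).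
  have gE : linfun gl =1 g by move=> x; rewrite lfunE.
  have k0 : lker (linfun gl) == 0%VS by apply/lker0P => x y; rewrite !gE; exact: ginj.
  exists ((linfun gl)^-1)%VF => x; rewrite -gE ?(lker0_lfunK k0) //.
  by rewrite (lker0_lfunVK k0).
move=> x; split=> [Mgx|Mx]; last first.
  by apply: (hcombine_mem hs) => // q; exact: (fz q).1.
rewrite -[x]hs_gen; apply: osm_sum => q; apply: osmZ; last exact: hs_mem hs q.
rewrite /hcoef -giso /g (hcombine_basis hs) -(subrr (a q)%:Z).
apply: pideal_div (hs_val hs q) _; rewrite -(hs_sym hs).
exact: (fz (s q)).2.
Qed.

End Frames.

End HyperbolicSystems.

Lemma lf_limit (k : localField) (c : nat -> k) :
  (forall n : nat, c n.+1 - c n \in pideal k n) ->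
  exists l, forall n : nat, l - c n \in pideal k n.
Proof.
move=> cS.
have cD i d : c (i + d)%N - c i \in pideal k i.
  elim: d => [|d IH]; first by rewrite addn0 subrr pideal0.
  rewrite addnS -(subrK (c (i + d)%N) (c _.+1)) -addrA pidealD //.
  by apply: pideal_le (cS _); lia.
have cC i j m : (m <= i)%N -> (m <= j)%N -> c i - c j \in pideal k m.
  move=> mi mj; rewrite -(subrK (c m) (c i)) -addrA -[c m - _]opprB.
  apply: pidealB; first by have := cD m (i - m)%N; rewrite subnKC.
  by have := cD m (j - m)%N; rewrite subnKC.
have [|l lP] := @lf_complete k c.
  move=> N; exists `|N|%N => i j mi mj; apply: pideal_le (cC _ _ _ mi mj); lia.
exists l => n; have [m mP] := lP n.
rewrite -(subrK (c (m + n)%N) l) -addrA -opprB.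
apply: pidealD; first by apply: pidealN; apply: mP; exact: leq_addr.
by apply: cC; rewrite ?leq_addl.
Qed.

(** * Lifting isometries from the levels of a tower and from their limit *)

Section TowerTheory.
Variables (k : localField) (W : vectType k) (beta : {skew_symmetric W}).
Variables (B : osubmod W) (T : tower beta B).
Local Notation M := (tw_top T).

Definition tw_form x y := unif ^ tw_exp T * beta x y.
Local Notation b := tw_form.

Hypothesis beta_alt : forall x, beta x x = 0.
Hypothesis beta_nondeg : forall x, (forall y, beta x y = 0) -> x = 0.
Hypothesis M_absorb : forall x, exists n, M (unif ^+ n *: x).
Hypothesis bot_ann : forall n x, tw_bot T n x <-> in_ann b M n x.
Hypothesis stab_top : forall g : Sp (beta : W -> W -> k),
  (forall x, M (g x) <-> M x) -> g \in stab_pred B.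

Lemma tw_form_lin c x y z : b (c *: x + y) z = c * b x z + b y z.
Proof. by rewrite /tw_form linearDl linearZl_LR /= mulrDr mulrCA. Qed.

Lemma tw_form_skew x y : b x y = - b y x.
Proof. by rewrite /tw_form beta_skew mulrN. Qed.

Lemma tw_form_alt x : b x x = 0.
Proof. by rewrite /tw_form beta_alt mulr0. Qed.

Lemma tw_form_unif0 : (unif ^ tw_exp T : k) != 0.
Proof. by rewrite expfz_neq0 ?unif_neq0. Qed.

Lemma tw_form_nondeg x : (forall y, b x y = 0) -> x = 0.
Proof.
move=> bx; apply: beta_nondeg => y; apply: (mulfI tw_form_unif0).
by rewrite mulr0; exact: bx.
Qed.

Lemma tw_ann_sub x : in_ann b M 0 x -> M x.
Proof. by move=> /bot_ann; exact: tw_sub. Qed.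

Let b_lin := tw_form_lin.
Let b_skew := tw_form_skew.
Let b_alt := tw_form_alt.
Let b_nondeg := tw_form_nondeg.
Let ann_sub := tw_ann_sub.
Let b_int : forall x y, M x -> M y -> b x y \in pideal k 0 := @tw_int _ _ _ _ T.

Lemma tower_basis : exists (I : finType) (s : I -> I) (e : I -> W) a,
  hyperbolic_system b M s e a /\ forall x, hcombine b s e e x = x.
Proof. exact: (hyperbolic_basis b_lin b_skew b_alt b_int b_nondeg M_absorb). Qed.

Lemma stab_form (g : stabilizer beta B) x y : b (g x) (g y) = b x y.
Proof. by rewrite /tw_form; have [_ _ ->] := SpP g. Qed.

Section Basis.
Variables (I : finType) (s : I -> I) (e : I -> W) (a : I -> nat).
Hypothesis hs : hyperbolic_system b M s e a.
Hypothesis hs_gen : forall x, hcombine b s e e x = x.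

Let E q : osub M := mkOsub (hs_mem hs q).

Lemma osub_gen (X : osub M) :
  X = \sum_q Integers (hcoef_int hs q (osubP X)) *: E q.
Proof.
apply: val_inj; rewrite -[LHS]hs_gen /hcombine.
rewrite (big_morph val (id1 := 0) (op1 := +%R)) //.
Qed.

Lemma tquot_lin n (u : tquot T n -> tquot T n) (c : I -> integers k) :
  linear u ->
  u (tpi n (\sum_q c q *: E q)) = \sum_q Opi n (c q) *: u (tpi n (E q)).
Proof.
move=> lu; have u0 : u 0 = 0.
  by have := lu (-1) 0 0; rewrite scaler0 addr0 scaleN1r addNr.
rewrite (big_morph (fun X => u (tpi n X)) (id1 := 0) (op1 := +%R)).
- apply: eq_bigr => q _.
  by have := lu (Opi n (c q)) (tpi n (E q)) 0; rewrite u0 !addr0 -tpiZ.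
- by move=> X Y; have := lu 1 (tpi n X) (tpi n Y); rewrite !scale1r -tpiD.
- by rewrite tpi0.
Qed.

Lemma tdot_eq n g (u : Spt T n) :
  (forall q, tpi n (tact g (E q)) = u (tpi n (E q))) -> tdot T n g = u.
Proof.
move=> gu; apply: Sp_ext => x; rewrite -[x]treprK (osub_gen (trepr x)).
rewrite !tquot_lin; [|by case: (SpP u)|by case: (SpP (tdot T n g))].
by apply: eq_bigr => q _; rewrite /= tdotfE gu.
Qed.

Lemma tdot_eq2 n (g h : stabilizer beta B) :
  tdot T n g = tdot T n h <-> forall q, in_ann b M n (g (e q) - h (e q)).
Proof.
split=> [gh q|gh].
  have /(congr1 (fun u : Spt T n => u (tpi n (E q)))) := gh.
  by rewrite /= !tdotfE => /tpi_eq/bot_ann.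
by apply: tdot_eq => q; rewrite /= tdotfE; apply/tpi_eq/bot_ann/gh.
Qed.

Lemma stab_frame (g : stabilizer beta B) : frame_vec b M a (fun q => g (e q)).
Proof.
move=> q; split; first exact/tw_stab_top/(hs_mem hs).
move=> x Mx; rewrite -(stab_form (g^-1)%g).
have -> : (g^-1)%g (g (e q)) = e q by exact: Sp_invK.
by apply: (hs_ideal hs); exact: tw_stab_top.
Qed.

Lemma frame_stab z : frame_vec b M a z -> (forall q, exact_at b e z q) ->
  exists g : stabilizer beta B, forall q, g (e q) = z q.
Proof.
move=> fz exz.
have [gl gb gi gM] := frame_isometry b_lin b_skew b_nondeg hs hs_gen fz exz.
have ga : isometric_aut (beta : W -> W -> k) (hcombine b s e z).
  by split=> // x y; apply: (mulfI tw_form_unif0); exact: gi.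
exists (Stab (stab_top (gM : forall x, M (toSp ga x) <-> M x))) => q /=.
exact: (hcombine_basis hs).
Qed.

Lemma tdot_surj n (u : Spt T n) : exists g, tdot T n g = u.
Proof.
have [ul _ ui] := SpP u.
have u0 : u 0 = 0.
  by have := ul (-1) 0 0; rewrite scaler0 addr0 scaleN1r addNr.
(* When n = 0 and a q = 1, e q vanishes in the quotient and an arbitrary lift *)
(* of its image would not be almost_isometric: keep e q itself.               *)
pose Z q := if (n == 0)%N && (a q == 1)%N then E q else trepr (u (tpi n (E q))).
have Zu q : tpi n (Z q) = u (tpi n (E q)).
  rewrite /Z; case: ifP => [/andP[/eqP n0 /eqP aq]|_]; last by rewrite treprK.
  suff -> : tpi n (E q) = 0 by rewrite u0.
  rewrite -tpi0; apply/tpi_eq; rewrite subr0 n0; apply/bot_ann => y My.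
  by rewrite b_skew pidealN // -aq; exact: (hs_ideal hs).
have Zdef q r : defect b e (fun q => val (Z q)) q r \in pideal k n.+1.
  have := ui (tpi n (E q)) (tpi n (E r)).
  by rewrite -!Zu !tformE => /Opi_eq.
have Zframe : frame_vec b M a (fun q => val (Z q)).
  move=> q; split; first exact: osubP.
  move=> x Mx; have := hs_le1 b_lin b_skew ann_sub hs q.
  case aq: (a q) => [|[|m]] // _; first by apply: b_int => //; exact: osubP.
  have [n0|n0] := posnP n.
    by rewrite /Z (introT eqP n0) aq /= -aq; exact: (hs_ideal hs).
  (* Here [a q = 1] and [n > 0]: [varpi^n e q] dies in the quotient, so [varpi^n Z q] does too,
     which makes the products of [Z q] with [M] divisible by [varpi]. *)
  have cO : (unif ^+ n : k) \in @intpred k.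
    by apply: pideal_le (pideal_unifX k n); lia.
  have : tpi n (Integers cO *: Z q) = tpi n 0.
    have := ul (Opi n (Integers cO)) (tpi n (E q)) 0.
    rewrite u0 !addr0 tpiZ Zu -tpiZ => <-.
    suff -> : tpi n (Integers cO *: E q) = 0 by rewrite u0 tpi0.
    rewrite -tpi0; apply/tpi_eq; rewrite subr0 /=; apply/bot_ann => y My.
    rewrite b_skew /tw_form linearZr_LR /= mulrCA pidealN //.
    rewrite -addn1 PoszD pideal_unifM -aq; exact: (hs_ideal hs).
  move=> /tpi_eq; rewrite subr0 /= => /bot_ann/(_ x Mx).
  rewrite /tw_form linearZl_LR /= mulrCA -addn1 PoszD pideal_unifM.
  by rewrite beta_skew mulrN => /pidealN; rewrite opprK.
(* The bound [n + 1] already implies [a q + a r] unless [n = 0] and [a q = a r = 1]; in that case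
   [Z] agrees with [E] and the defect is zero. *)
have Zalm : almost_isometric b e a n (fun q => val (Z q)).
  move=> q r; split=> //.
  have aq := hs_le1 b_lin b_skew ann_sub hs q.
  have ar := hs_le1 b_lin b_skew ann_sub hs r.
  have [/andP[n0 /andP[aq1 ar1]]|h] :=
      boolP ((n == 0)%N && ((a q == 1)%N && (a r == 1)%N)).
    by rewrite /defect /Z n0 aq1 ar1 /= subrr pideal0.
  apply: pideal_le (Zdef q r); lia.
have [z [zZ exz]] := gram_schmidt b_lin b_skew b_alt ann_sub hs Zframe Zalm.
have [g gz] := frame_stab (frame_vec_near b_lin b_skew ann_sub hs zZ Zframe) exz.
exists g; apply: tdot_eq => q; rewrite -Zu; apply/tpi_eq/bot_ann.
by rewrite /= gz; exact: zZ.
Qed.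

Lemma hcoef_ann n x q : in_ann b M n x -> hcoef b s e x q \in pideal k n.
Proof.
move=> xn; have := pideal_div (hs_val hs q) (xn _ (hs_mem hs (s q))).
by apply: pideal_le; have := hs_le1 b_lin b_skew ann_sub hs q; lia.
Qed.

Lemma ann_limit (w : nat -> W) : (forall n, in_ann b M n (w n.+1 - w n)) ->
  exists l, forall n, in_ann b M n (l - w n).
Proof.
move=> wS.
have cB x y q : hcoef b s e (x - y) q = hcoef b s e x q - hcoef b s e y q.
  by rewrite addrC -scaleN1r (hcoef_lin b_lin) mulN1r addrC.
have lex q : exists c : k, forall n : nat, c - hcoef b s e (w n) q \in pideal k n.
  by apply: lf_limit => n; rewrite -cB; exact: hcoef_ann.
pose c q := sval (cid (lex q)).
have cP q n : c q - hcoef b s e (w n) q \in pideal k n by rewrite /c; case: cid.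
exists (\sum_q c q *: e q) => n.
(* [hcoef_ann] loses one power of the uniformizer, so the limit is compared with [w n.+1] to reach
   [in_ann] at level [n]. *)
rewrite -(subrK (w n.+1) (\sum_q _)) -addrA; apply: (in_annD b_lin) => // y My.
rewrite -[w n.+1]hs_gen /hcombine -sumrB.
apply: (big_ind (fun x => b x y \in pideal k n.+1)) => [|x x' hx hx'|q _].
- by rewrite /tw_form linear0l mulr0 pideal0.
- by rewrite /tw_form linearDl mulrDr pidealD.
rewrite -scalerBl /tw_form linearZl_LR /= mulrCA -[n.+1%:Z]addr0.
by apply: pidealM (cP q n.+1) _; apply: b_int => //; exact: (hs_mem hs).
Qed.

Lemma stab_eq (g h : stabilizer beta B) :
  (forall q, g (e q) = h (e q)) -> g = h.
Proof.
move=> gh; apply: val_inj; apply: Sp_ext => x.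
suff key (f : stabilizer beta B) : f x = hcombine b s e (fun q => f (e q)) x.
  rewrite [LHS]key [RHS]key.
  by apply: eq_bigr => q _; rewrite gh.
have [fl _ _] := SpP f.
pose fL : {linear W -> W} := HB.pack (f : W -> W) (GRing.isLinear.Build _ _ _ _ (f : W -> W) fl).
rewrite -[LHS]/(fL x) -{1}[x]hs_gen /hcombine linear_sum.
by apply: eq_bigr => q _; rewrite linearZ.
Qed.

Lemma tdot_lim_inj : injective (tdot_lim T).
Proof.
move=> g h gh; apply: stab_eq => q; apply/eqP; rewrite -subr_eq0; apply/eqP.
apply: (in_ann_cap b_lin b_skew b_nondeg M_absorb) => n.
have /tdot_eq2 : tdot T n g = tdot T n h; last exact.
by rewrite -[tdot T n g]/(tdot_lim T g n) gh.
Qed.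

(** Lifts of consecutive components agree modulo [N_n], so their values on the basis converge. The
    limits form a frame, whose defects lie in every power of the maximal ideal and thus vanish. *)
Lemma tdot_lim_surj u : exists g, tdot_lim T g = u.
Proof.
pose g n := sval (cid (tdot_surj (u n))).
have gu n : tdot T n (g n) = u n by rewrite /g; case: cid.
have gS q n : in_ann b M n (g n.+1 (e q) - g n (e q)).
  move: q; apply/tdot_eq2; rewrite gu -(projlimP u) -gu.
  exact/esym/tdot_compat.
pose z q := sval (cid (ann_limit (gS q))).
have zg q n : in_ann b M n (z q - g n (e q)) by rewrite /z; case: cid.
have fz : frame_vec b M a z.
  exact: (frame_vec_near b_lin b_skew ann_sub hs (zg^~ 0%N) (stab_frame (g 0%N))).
have exz q : exact_at b e z q.
  move=> r; apply: pideal_cap0 => n; apply: (@pideal_le _ _ n.+1); first by lia.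
  rewrite /defect -(stab_form (g n) (e q)).
  have -> : b (z q) (z r) - b (g n (e q)) (g n (e r)) =
      b (z q - g n (e q)) (z r) - b (z r - g n (e r)) (g n (e q)).
    rewrite [b (z r - _) _]b_skew opprK /tw_form !linearBl !linearBr /=; ring.
  apply: pidealB; apply: zg; first exact: (fz r).1.
  by apply: tw_stab_top; exact: (hs_mem hs).
have [h hz] := frame_stab fz exz.
exists h; apply: projlim_ext => n /=; rewrite -gu; apply/tdot_eq2 => q.
by rewrite hz.
Qed.

End Basis.
End TowerTheory.

(** * Comparison of the topologies *)

Lemma fin_uniform (I : finType) (P : I -> nat -> Prop) :
  (forall i m n, (m <= n)%N -> P i m -> P i n) ->
  (forall i, exists n, P i n) -> exists n, forall i, P i n.
Proof.
move=> mono ex; pose f i := sval (cid (ex i)).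
have fP i : P i (f i) by rewrite /f; case: cid.
exists (\max_i f i)%N => i; apply: mono (fP i); exact: (leq_bigmax i).
Qed.

Lemma nbhs_lftopP (k : localField) (x : lftop k) (U : set (lftop k)) :
  nbhs x U <-> exists n : nat, forall y : k, y - (x : k) \in pideal k n -> U y.
Proof.
rewrite nbhsE; split=> [[O [oO Ox] OU]|[n nU]].
  have [N NO] := oO _ Ox; exists `|N|%N => y yx; apply/OU/NO.
  by apply: pideal_le yx; lia.
exists [set y : k | y - (x : k) \in pideal k n] => //.
split; last by rewrite /= subrr pideal0.
move=> y yx; exists n => z zy; rewrite /= -(subrK (y : k) z) -addrA.
exact: pidealD.
Qed.

Section VectorTopology.
Variables (k : localField) (V : vectType k).

Lemma nbhs_vtopP (v : vtop V) (U : set (vtop V)) :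
  nbhs v U <-> exists n : nat, forall w : V,
    (forall j, v2r (w - (v : V)) 0 j \in pideal k n) -> U w.
Proof.
have vB w j : v2r (w - (v : V)) 0 j = v2r w 0 j - v2r v 0 j.
  by rewrite raddfB !mxE.
split=> [|[n nU]].
  rewrite nbhsE => -[_ [[A oA <-] Av] AU].
  have [P vP PA] : nbhs (v2r v : 'rV[lftop k]_(dim V)) A by apply: open_nbhs_nbhs.
  have [|j|n nP] := @fin_uniform 'I_(dim V) (fun j n => forall y : k,
      y - v2r v 0 j \in pideal k n -> P 0 j y).
  - by move=> j m n mn Pm y yn; apply: Pm; apply: pideal_le yn.
  - exact/nbhs_lftopP/vP.
  exists n => w wn; apply: AU; apply: PA => i j; rewrite ord1.
  by apply: nP; rewrite -vB.
apply: (@filterS _ (nbhs v) _ (v2r @^-1` [set r : 'rV[lftop k]_(dim V) |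
  forall j, (r 0 j : k) - v2r v 0 j \in pideal k n])).
  by move=> w wn; apply: nU => j; rewrite vB; exact: wn.
apply: (@initial_continuous _ _ (v2r : V -> 'rV[lftop k]_(dim V))).
exists (fun i j => [set y : k | y - v2r v 0 j \in pideal k n]).
  by move=> i j; rewrite ord1; apply/nbhs_lftopP; exists n.
by move=> r rP j; exact: rP.
Qed.

Lemma v2r_sum_delta (v : V) : v = \sum_j v2r v 0 j *: r2v (delta_mx 0 j).
Proof.
apply: v2r_inj; rewrite linear_sum [LHS]row_sum_delta.
by apply: eq_bigr => j _; rewrite linearZ_LR /= r2vK.
Qed.

End VectorTopology.

Section TowerTopology.
Variables (k : localField) (W : vectType k) (beta : {skew_symmetric W}).
Variables (B : osubmod W) (T : tower beta B).
Local Notation M := (tw_top T).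
Local Notation b := (tw_form T).
Hypothesis beta_alt : forall x, beta x x = 0.
Hypothesis beta_nondeg : forall x, (forall y, beta x y = 0) -> x = 0.
Hypothesis M_absorb : forall x, exists n, M (unif ^+ n *: x).
Hypothesis bot_ann : forall n x, tw_bot T n x <-> in_ann b M n x.
Hypothesis stab_top : forall g : Sp (beta : W -> W -> k),
  (forall x, M (g x) <-> M x) -> g \in stab_pred B.
Variables (I : finType) (s : I -> I) (e : I -> W) (a : I -> nat).
Hypothesis hs : hyperbolic_system b M s e a.
Hypothesis hs_gen : forall x, hcombine b s e e x = x.


Lemma form_bounded w : exists m : nat, forall y, M y -> b w y \in pideal k (- m%:Z).
Proof.
have [m Mw] := M_absorb w; exists m => y My.
rewrite -(pideal_unifM _ m) subrr.
have <- : b (unif ^+ m *: w) y = unif ^+ m * b w y.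
  by rewrite /tw_form linearZl_LR /= mulrCA.
exact: tw_int.
Qed.

(** With the next lemma, this says that the coordinate topology on endomorphisms is the one defined
    by the [N_n] on the basis. The finitely many basis endomorphisms have bounded denominators. *)
Lemma small_coord_ann n : exists N : nat, forall phi : 'End(W),
  (forall j, v2r phi 0 j \in pideal k N) -> forall q, in_ann b M n (phi (e q)).
Proof.
pose d j : 'End(W) := r2v (delta_mx 0 j).
have [|qj|m mP] := @fin_uniform (I * 'I_(dim 'End(W)))%type (fun qj m =>
    forall y, M y -> b (d qj.2 (e qj.1)) y \in pideal k (- m%:Z)).
- by move=> qj m m' mm' h y My; apply: pideal_le (h y My); lia.
- exact: form_bounded.
exists (n.+1 + m)%N => phi phiN q y My.
rewrite [phi]v2r_sum_delta sum_lfunE.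
apply: (big_ind (fun x => b x y \in pideal k n.+1)) => [|x x' hx hx'|j _].
- by rewrite /tw_form linear0l mulr0 pideal0.
- by rewrite /tw_form linearDl mulrDr pidealD.
rewrite scale_lfunE /tw_form linearZl_LR /= mulrCA.
by apply: pideal_le (pidealM (phiN j) (mP (q, j) y My)); lia.
Qed.

Lemma ann_small_coord N : exists n, forall phi : 'End(W),
  (forall q, in_ann b M n (phi (e q))) -> forall j, v2r phi 0 j \in pideal k N.
Proof.
have lin q r : linear (fun x : W => hcoef b s e x q *: e r).
  move=> c x y; rewrite (hcoef_lin (@tw_form_lin _ _ _ _ T)).
  by rewrite scalerDl scalerA.
pose d (qr : I * I) : 'End(W) := linfun (HB.pack_for {linear W -> W}
  (fun x : W => hcoef b s e x qr.1 *: e qr.2)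
  (GRing.isLinear.Build _ _ _ _ _ (lin qr.1 qr.2))).
have [|qj|m mP] := @fin_uniform ((I * I) * 'I_(dim 'End(W)))%type (fun qj m =>
    v2r (d qj.1) 0 qj.2 \in pideal k (- m%:Z)).
- by move=> qj m m' mm' h; apply: pideal_le h; lia.
- exact: pideal_ex.
exists (`|N| + m)%N => phi phin j.
(* The maps [d] are the matrix units of the basis [e]. *)
have -> : phi = \sum_(qr : I * I) hcoef b s e (phi (e qr.1)) qr.2 *: d qr.
  apply/lfunP => x; rewrite sum_lfunE -{1}[x]hs_gen /hcombine linear_sum /=.
  rewrite -(pair_bigA _ (fun q r => (hcoef b s e (phi (e q)) r *: d (q, r)) x)) /=.
  apply: eq_bigr => q _; rewrite linearZ /= -{1}[phi (e q)]hs_gen /hcombine.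
  rewrite scaler_sumr; apply: eq_bigr => r _.
  by rewrite scale_lfunE lfunE /= !scalerA mulrC.
rewrite linear_sum summxE; apply: pideal_sum => qr.
rewrite linearZ mxE.
have := hcoef_ann bot_ann hs qr.2 (phin qr.1) => h.
by apply: pideal_le (pidealM h (mP (qr, j))); lia.
Qed.

Lemma nbhs_stabP (g : stabilizer beta B) (U : set (stabilizer beta B)) :
  nbhs g U <-> exists n, forall h, tdot T n h = tdot T n g -> U h.
Proof.
have gE (f : stabilizer beta B) x : linfun (f : W -> W) x = f x.
  have [fl _ _] := SpP f.
  pose fL : {linear W -> W} :=
    HB.pack (f : W -> W) (GRing.isLinear.Build _ _ _ _ (f : W -> W) fl).
  exact: (lfunE fL).
split=> [|[n nU]].
  rewrite nbhsE => -[_ [[A oA <-] Ag] AU].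
  have : nbhs (linfun (g : W -> W) : vtop 'End(W)) A by apply: open_nbhs_nbhs.
  move=> /nbhs_vtopP[N NA]; have [n nP] := ann_small_coord N.
  exists n => h /(tdot_eq2 bot_ann hs hs_gen) hg; apply/AU/NA/nP => q.
  by rewrite add_lfunE opp_lfunE !gE.
have [N NP] := small_coord_ann n.
apply: (@filterS _ (nbhs g) _ ((fun f : stabilizer beta B =>
    linfun (f : W -> W) : vtop 'End(W)) @^-1` [set phi : 'End(W) |
    forall j, v2r (phi - linfun (g : W -> W)) 0 j \in pideal k N])).
  move=> h hN; apply: nU; apply/(tdot_eq2 bot_ann hs hs_gen) => q.
  by have := NP _ hN q; rewrite add_lfunE opp_lfunE !gE.
apply: (@initial_continuous _ _ (fun f : stabilizer beta B =>
    linfun (f : W -> W) : vtop 'End(W))).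
by apply/nbhs_vtopP; exists N.
Qed.

Lemma tdot_lim_iso : topgroup_iso (tdot_lim T).
Proof.
split.
  move=> g h; apply: projlim_ext => n; apply: Sp_ext => x.
  rewrite -[x]treprK.
  transitivity (tdot T n g (tdot T n h (tpi n (trepr x)))); last by [].
  by rewrite /= !tdotfE; congr tpi; exact: val_inj.
have inj := tdot_lim_inj beta_nondeg M_absorb bot_ann hs hs_gen.
have sur := tdot_lim_surj beta_alt beta_nondeg bot_ann stab_top hs hs_gen.
pose G u := sval (cid (sur u)).
have GK : cancel G (tdot_lim T) by move=> u; rewrite /G; case: cid.
exists G; split=> //; first by move=> g; apply: inj; rewrite GK.
  apply: continuous_comp_initial => g.
  have Fg : Filter (nbhs g) by exact: nbhs_filter.
  apply/cvg_sup => n U.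
  rewrite nbhsE => -[_ [[A oA <-] Ag] AU]; apply/nbhs_stabP; exists n => h hg.
  apply: AU.
  by rewrite /= hg.
move=> u U /nbhs_stabP[n nU].
pose P := prod_topology (fun n => discrete_topology (Spt T n)).
(* The factor at level [n] is discrete, so fixing the component there is an open condition. *)
have : nbhs (pl_val u : P) [set x : P | x n = u n].
  have /(_ [set u n]) := @proj_continuous _
    (fun n => discrete_topology (Spt T n)) n (pl_val u).
  by apply; exact: discrete_set1.
move=> /(@initial_continuous _ _ (@pl_val (fun n => Spt T n) (tred T) : _ -> P)) nu.
apply: (@filterS _ (nbhs u) _ _ _ _ nu) => v vn; apply: nU.
transitivity (tdot_lim T (G v) n); first by [].
by rewrite GK vn -{1}(GK u).
Qed.

End TowerTopology.

Lemma tower_theorem (k : localField) (W : vectType k)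
    (beta : {skew_symmetric W}) (B : osubmod W) (T : tower beta B) :
  (forall x, beta x x = 0) ->
  (forall x, (forall y, beta x y = 0) -> x = 0) ->
  (forall x, exists n, tw_top T (unif ^+ n *: x)) ->
  (forall n x, tw_bot T n x <-> in_ann (tw_form T) (tw_top T) n x) ->
  (forall g : Sp (beta : W -> W -> k),
    (forall x, tw_top T (g x) <-> tw_top T x) -> g \in stab_pred B) ->
  (forall n (u : Spt T n), exists v : Spt T n.+1, tred T n v = u) /\
  topgroup_iso (tdot_lim T).
Proof.
move=> alt nondeg absorb bot_ann stab.
have [I [s [e [a [hs gen]]]]] := tower_basis alt nondeg absorb.
split; last exact: (tdot_lim_iso alt nondeg absorb bot_ann stab hs gen).
move=> n u; have [g <-] := tdot_surj alt nondeg bot_ann stab hs gen u.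
by exists (tdot T n.+1 g); exact: tdot_compat.
Qed.

(** * The towers of a good lattice *)

Lemma open_absorb (k : localField) (W : vectType k) (B : osubmod W) :
  open (B : set (vtop W)) -> forall x, exists n, B (unif ^+ n *: x).
Proof.
move=> oB x.
have : nbhs (0 : vtop W) (B : set (vtop W)).
  by apply: open_nbhs_nbhs; split=> //; exact: osm0.
move=> /nbhs_vtopP[N NB].
have [|j|m mP] := @fin_uniform 'I_(dim W) (fun j m =>
    v2r x 0 j \in pideal k (- m%:Z)).
- by move=> j m n mn; apply: pideal_le; lia.
- exact: pideal_ex.
exists (N + m)%N; apply: NB => j; rewrite subr0 linearZ_LR mxE.
by apply: pideal_le (pidealM (pideal_unifX k (N + m)) (mP j)); lia.
Qed.

Section GoodLatticeTowers.
Variables (k : localField) (W : vectType k) (beta : {skew_symmetric W}).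
Variables (lambda : int) (B : osubmod W).
Hypothesis goodB : good beta lambda B.
Hypothesis beta_alt : forall x, beta x x = 0.
Hypothesis beta_nondeg : forall x, (forall y, beta x y = 0) -> x = 0.
Hypothesis B_absorb : forall x, exists n, B (unif ^+ n *: x).

Lemma pideal_scaled N (n : nat) (c : k) :
  (unif ^ (- N) * c \in pideal k n) = (c \in pideal k (n%:Z + N)).
Proof.
apply/idP/idP => h.
  rewrite -[c](mulKf (expfz_neq0 (- N) (@unif_neq0 k))) invr_expz opprK.
  by rewrite [n%:Z + N]addrC; apply: pidealM => //; exact: pideal_unifz.
by rewrite -[n%:Z](addKr N) [N + _]addrC; apply: pidealM => //; exact: pideal_unifz.
Qed.

Lemma mem_scaled_dual (M : osubmod W) N n x :
  osm_scale (unif ^+ n) (dual beta N M) x <->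
  forall y, M y -> beta x y \in pideal k (n%:Z + N).
Proof.
have u0 : (unif ^+ n : k) != 0 by rewrite expf_neq0 ?unif_neq0.
split=> [[z dz <-] y My|h].
  by rewrite linearZl_LR /= pideal_unifM; exact: dz.
exists (unif ^- n *: x); last by rewrite scalerA divff // scale1r.
move=> y My; rewrite -(pideal_unifM _ n) linearZl_LR /= mulVKf //; exact: h.
Qed.

Lemma tower_b_ann n x : tw_bot (tower_b goodB) n x <->
  in_ann (tw_form (tower_b goodB)) (tw_top (tower_b goodB)) n x.
Proof.
apply: (iff_trans (mem_scaled_dual B lambda n.+1 x)).
by split=> h y By; have := h y By; rewrite /tw_form /= pideal_scaled.
Qed.

(** By [hs_ideal], the vector [varpi^(- a q) e q] lies in [B^*]. Pairing [x] with these vectors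
    shows that its coordinates in the hyperbolic basis are integral. *)
Lemma dual_dual x : (forall y, dual beta lambda B y -> beta x y \in pideal k lambda) -> B x.
Proof.
move=> h; pose T := tower_b goodB.
have [I [s [e [a [hs gen]]]]] :=
  @tower_basis _ _ _ _ T beta_alt beta_nondeg B_absorb.
rewrite -[x]gen; apply: osm_sum => q; apply: osmZ; last exact: hs_mem hs q.
rewrite /hcoef -(subrr (a q)%:Z); apply: pideal_div (hs_val hs q) _.
rewrite -(hs_sym hs) /tw_form /= pideal_scaled.
set f := e (s q); set c := a (s q).
have u0 : (unif ^+ c : k) != 0 by rewrite expf_neq0 ?unif_neq0.
have -> : f = unif ^+ c *: (unif ^- c *: f) by rewrite scalerA divff // scale1r.
rewrite linearZr_LR /= pideal_unifM; apply: h => y By.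
rewrite -(pideal_unifM _ c) linearZl_LR /= mulVKf // -pideal_scaled beta_skew mulrN.
by apply: pidealN; exact: (hs_ideal hs (s q) By).
Qed.

Lemma tower_bstar_ann n x : tw_bot (tower_bstar goodB) n x <->
  in_ann (tw_form (tower_bstar goodB)) (tw_top (tower_bstar goodB)) n x.
Proof.
have bE y : (tw_form (tower_bstar goodB) x y \in pideal k n.+1) =
    (beta x y \in pideal k (n%:Z + lambda)).
  rewrite /tw_form /= -[1 - lambda]opprB pideal_scaled; congr (_ \in pideal k _); lia.
split=> [[z Bz zx] y dy|h].
  rewrite bE -zx linearZl_LR /= pideal_unifM beta_skew.
  by apply: pidealN; exact: dy.
have : osm_scale (unif ^+ n) (dual beta lambda (dual beta lambda B)) x.
  by apply/mem_scaled_dual => y dy; rewrite -bE; exact: h.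
by move=> [z dz <-]; exists z => //; apply: dual_dual.
Qed.

Lemma stab_predI (g : Sp (beta : W -> W -> k)) :
  (forall x, B (g x) <-> B x) -> g \in stab_pred B.
Proof.
move=> gB; apply/stab_predP/seteqP; split=> [_ [x Bx <-]|x Bx]; first exact/gB.
by exists (Sp_inv g x); [apply/gB|]; rewrite Sp_Kinv.
Qed.

Lemma stab_pred_dual (g : Sp (beta : W -> W -> k)) :
  (forall x, dual beta lambda B (g x) <-> dual beta lambda B x) ->
  g \in stab_pred B.
Proof.
move=> gD; have [_ _ gi] := SpP g.
apply: stab_predI => x; split=> Bx; apply: dual_dual => y dy.
  by rewrite -gi beta_skew; apply: pidealN; apply/(gD y).2.
rewrite -(Sp_Kinv g y) gi beta_skew; apply: pidealN.
by apply: (gD (Sp_inv g y)).1 => //; rewrite Sp_Kinv.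
Qed.

End GoodLatticeTowers.

Theorem mainTheorem10
  (k : localField)
  (char0 : [pchar k] =i pred0)
  (odd_residue_char : 2%N \notin [pchar (residue_field k)])
  (lambda : int)
  (W : vectType k) (beta : {skew_symmetric W})
  (symplectic : is_psymplectic beta)
  (B : osubmod W) (latticeB : is_lattice B) (goodB : good beta lambda B) :
  (forall n : nat,
     (forall u : Spt (tower_b goodB) n,
        exists v : Spt (tower_b goodB) n.+1, tred (tower_b goodB) n v = u) /\
     (forall u : Spt (tower_bstar goodB) n,
        exists v : Spt (tower_bstar goodB) n.+1,
          tred (tower_bstar goodB) n v = u)) /\
  (topgroup_iso (tdot_lim (tower_b goodB)) /\
   topgroup_iso (tdot_lim (tower_bstar goodB))).
Proof.
have alt x : beta x x = 0.
  (* Skew-symmetry gives [2 * beta x x = 0], and 2 is invertible in characteristic 0. *)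
  have two0 : (2%:R : k) != 0 by have := char0 2%N; rewrite inE /= => /negbT.
  apply: (mulfI two0); rewrite mulr0 mulr_natl mulr2n.
  by rewrite {1}(beta_skew beta x x) addNr.
have nondeg x : (forall y, beta x y = 0) -> x = 0.
  move=> bx; have [/eqP rad0 _ _] := symplectic.
  apply/eqP; rewrite -memv0 -rad0; apply/mem_orthovP => y _; exact: bx.
have absB := open_absorb latticeB.2.
have absD x : exists n, dual beta lambda B (unif ^+ n *: x).
  by have [n Bn] := absB x; exists n; exact: goodB.2.
have [b_surj b_iso] := @tower_theorem _ _ _ _ (tower_b goodB) alt nondeg absB
  (tower_b_ann goodB) (@stab_predI _ _ _ _).
have [bs_surj bs_iso] := @tower_theorem _ _ _ _ (tower_bstar goodB) alt nondeg
  absD (tower_bstar_ann goodB alt nondeg absB)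
  (@stab_pred_dual _ _ _ _ _ goodB alt nondeg absB).
by split=> // n; split.
Qed.
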